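(* For every $n\ge1$, the common denominator (in $\mathbb{Q}[q]$) of the coefficients of the homogeneous component $\Omega_{q,n}$ of degree $n$ of $\Omega_q$ divides the product $\prod_{d=2}^{n}\Phi_d$, where $\Phi_d\in\mathbb{Z}[q]$ is the $d$-th cyclotomic polynomial.
   Context: For a field $K$ ($K=\mathbb{Q}$ or $\mathbb{Q}(q)$, $q$ an indeterminate), $\mathrm{PL}=\bigoplus_{n\ge1}\mathrm{PL}_n$ is the $K$-vector space with basis the isomorphism classes of (unlabeled, non-planar) rooted trees, graded by the number $\#T$ of vertices. The pre-Lie product is $T\curvearrowleft T'=\sum_{v}$ (tree obtained from $T\sqcup T'$ by adding an edge from the root of $T'$ to $v$), sum over vertices $v$ of $T$, the root being that of $T$. Denote by $\bullet$ the one-vertex tree; $\mathrm{PL}$ is the free (right) pre-Lie algebra on $\bullet$, and a Lie algebra for $[x,y]=x\curvearrowleft y-y\curvearrowleft x$. Let $\widehat{\mathrm{PL}}=\prod_{n\ge1}\mathrm{PL}_n$ and let $\widehat U(\mathrm{PL})$ be the (degree-)completed universal enveloping algebra, with associative product $\star$. The product $\curvearrowleft$ is a right action of the Lie algebra, so extends to a right action of $\widehat U(\mathrm{PL})$ on $\widehat{\mathrm{PL}}$: $x\curvearrowleft(u\star v)=(x\curvearrowleft u)\curvearrowleft v$. Exponentials are computed in $\widehat U(\mathrm{PL})$. $\Omega\in\widehat{\mathrm{PL}}_{\mathbb{Q}}$ is the unique solution of $\bullet\curvearrowleft\left(\frac{\Omega}{\exp(\Omega)-1}\right)=\Omega$,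 where $\frac{x}{e^x-1}$ is expanded as a power series. For $A=\sum_{n\ge 1}A_n$ (homogeneous components), $A[q]=\sum_n q^nA_n$. $\Omega_q=\sum_{n\ge1}\Omega_{q,n}\in\widehat{\mathrm{PL}}_{\mathbb{Q}(q)}$ ($\Omega_{q,n}$ homogeneous of degree $n$) is the unique solution of $$\Omega_q[q]\curvearrowleft(\exp(\Omega)-1)+\Omega_q[q]-\Omega_q=\bullet\curvearrowleft\Omega_q+(q-1)\bullet .$$ Its coefficients are those in the basis of rooted trees. *)

(* Defs.v *)
From HB Require Import structures.
From mathcomp Require Import all_boot all_order all_algebra all_field.
From mathcomp Require Import boolp functions ring.
From mathcomp Require Import generic_quotient ring_quotient fraction.

Set Implicit Arguments.
Unset Strict Implicit.
Unset Printing Implicit Defensive.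

Import GRing.Theory.
Local Open Scope ring_scope.
Local Open Scope quotient_scope.

Inductive ptree := Node of seq ptree.

Definition leaf := Node [::].

Section PtreeInd.
Variables (Q : seq ptree -> Prop) (P : ptree -> Prop).
Hypothesis PNode : forall s, Q s -> P (Node s).
Hypothesis Qnil : Q [::].
Hypothesis Qcons : forall t s, P t -> Q s -> Q (t :: s).

Fixpoint ptree_seq_ind (t : ptree) : P t :=
  let: Node s := t in
  PNode ((fix aux s : Q s :=
    match s with
    | [::] => Qnil
    | t :: s' => Qcons (ptree_seq_ind t) (aux s')
    end) s).

End PtreeInd.

Fixpoint ptree_code (t : ptree) : GenTree.tree unit :=
  let: Node s := t in GenTree.Node 0 (map ptree_code s).

Fixpoint ptree_decode (c : GenTree.tree unit) : ptree :=
  if c is GenTree.Node _ s then Node (map ptree_decode s) else leaf.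

Lemma ptree_codeK : cancel ptree_code ptree_decode.
Proof.
apply: (@ptree_seq_ind (fun s => map ptree_decode (map ptree_code s) = s)).
- by move=> s /= ->.
- by [].
- by move=> t s /= -> ->.
Qed.

HB.instance Definition _ := Countable.copy ptree (can_type ptree_codeK).

Fixpoint psize (t : ptree) : nat :=
  let: Node s := t in (sumn (map psize s)).+1.

Inductive tree_iso : ptree -> ptree -> Prop :=
| iso_leaf : tree_iso leaf leaf
| iso_node t t' s s1 s2 :
    tree_iso t t' -> tree_iso (Node s) (Node (s1 ++ s2)) ->
    tree_iso (Node (t :: s)) (Node (s1 ++ t' :: s2)).

(* Canonical representative of an isomorphism class: sort the children,       *)
(* recursively, along an arbitrary total order. tnorm_iso below shows that    *)
(* equality of canonical representatives is isomorphism of rooted trees.      *)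
Definition ple (t u : ptree) : bool := (pickle t <= pickle u)%N.

Fixpoint tnorm (t : ptree) : ptree :=
  let: Node s := t in Node (sort ple (map tnorm s)).

Lemma ple_total : total ple. Proof. by move=> t u; exact: leq_total. Qed.
Lemma ple_trans : transitive ple. Proof. by move=> t u v; exact: leq_trans. Qed.
Lemma ple_anti : antisymmetric ple.
Proof.
by move=> t u; rewrite -eqn_leq => /eqP; apply: (pcan_inj pickleK).
Qed.

Lemma tnorm_Node s s' :
  (tnorm (Node s) = tnorm (Node s')) <-> perm_eq (map tnorm s) (map tnorm s').
Proof.
split=> [[] /(perm_sortP ple_total ple_trans ple_anti) //|h /=].
by congr Node; apply/(perm_sortP ple_total ple_trans ple_anti).
Qed.

Lemma tnorm_idem t : tnorm (tnorm t) = tnorm t.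
Proof.
elim/(@ptree_seq_ind (fun s => map tnorm (map tnorm s) = map tnorm s)): t => //.
- move=> s hs; change (tnorm (Node (sort ple (map tnorm s))) = tnorm (Node s)).
  by apply/tnorm_Node; rewrite -{2}hs perm_map // perm_sort.
- by move=> t s /= -> ->.
Qed.

Lemma map_tnorm_idem s : map tnorm (map tnorm s) = map tnorm s.
Proof. by rewrite -map_comp; apply: eq_map => t /=; rewrite tnorm_idem. Qed.

Lemma psize_tnorm t : psize (tnorm t) = psize t.
Proof.
elim/(@ptree_seq_ind
  (fun s => sumn (map psize (map tnorm s)) = sumn (map psize s))): t => //.
- move=> s /= <-; congr S.
  by apply: perm_sumn; rewrite perm_map // perm_sort.
- by move=> t s /= -> ->.
Qed.

Lemma perm_mid (T : eqType) (a : T) s s1 s2 :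
  perm_eq (a :: s) (s1 ++ a :: s2) = perm_eq s (s1 ++ s2).
Proof. by rewrite perm_sym (perm_catCA s1 [:: a] s2) perm_cons perm_sym. Qed.

Lemma tree_iso_tnorm t t' : tree_iso t t' -> tnorm t = tnorm t'.
Proof.
elim=> // {}t {}t' s s1 s2 _ ht _ /tnorm_Node hs.
by apply/tnorm_Node; rewrite map_cat !map_cons -ht perm_mid -map_cat.
Qed.

Lemma tnorm_iso t t' : tnorm t = tnorm t' <-> tree_iso t t'.
Proof.
split; last exact: tree_iso_tnorm.
elim/(@ptree_seq_ind (fun s => forall s',
  perm_eq (map tnorm s) (map tnorm s') -> tree_iso (Node s) (Node s'))): t t'.
- by move=> s hs [s'] /tnorm_Node; apply: hs.
- by case=> [_|//]; [exact: iso_leaf | move=> ? ? /perm_size].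
- move=> t s ht hs s' h.
  have /mapP[t'] : tnorm t \in map tnorm s' by rewrite -(perm_mem h) mem_head.
  move=> /splitPr t's' tt'; case: t's' h => s1 s2 h.
  apply: iso_node; first exact: ht.
  by apply: hs; move: h; rewrite !map_cat !map_cons -tt' perm_mid.
Qed.

Record rtree := RTree { ptree_of :> ptree; _ : tnorm ptree_of == ptree_of }.

HB.instance Definition _ := [isSub for ptree_of].
HB.instance Definition _ := [Countable of rtree by <:].

Definition tclass (t : ptree) : rtree := RTree (introT eqP (tnorm_idem t)).

Lemma tclassP t t' : tclass t = tclass t' <-> tree_iso t t'.
Proof.
split=> [/(congr1 ptree_of) h|/tnorm_iso h]; first exact/tnorm_iso.
exact: val_inj.
Qed.

Lemma ptree_ofK (T : rtree) : tclass T = T.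
Proof. by apply/val_inj/eqP; case: T. Qed.

Definition rsize (T : rtree) : nat := psize T.

Lemma rsize_tclass t : rsize (tclass t) = psize t.
Proof. exact: psize_tnorm. Qed.

Definition bullet : rtree := tclass leaf.

(* Given g, listing the outcomes of an operation on a tree, list the outcomes *)
(* of that operation on one tree of a forest.                                 *)
Definition on_forest (g : ptree -> seq ptree) : seq ptree -> seq (seq ptree) :=
  fix f s :=
    if s is a :: s' then [seq a' :: s' | a' <- g a] ++ [seq a :: s'' | s'' <- f s']
    else [::].

(* The list, indexed by the vertices v of t, of the trees obtained by adding  *)
(* an edge from the root of u to v.                                           *)
Fixpoint grafts (u t : ptree) : seq ptree :=
  let: Node s := t in Node (u :: s) :: map Node (on_forest (grafts u) s).

Definition lgrafts (u : ptree) := on_forest (grafts u).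

Lemma graftsE u s : grafts u (Node s) = Node (u :: s) :: map Node (lgrafts u s).
Proof. by []. Qed.

Lemma size_grafts u t : size (grafts u t) = psize t.
Proof.
elim/(@ptree_seq_ind (fun s => size (lgrafts u s) = sumn (map psize s))): t => //.
- by move=> s hs; rewrite graftsE /= size_map hs.
- by move=> t s ht hs /=; rewrite size_cat !size_map ht hs.
Qed.

Lemma psize_grafts u t t' : t' \in grafts u t -> psize t' = (psize t + psize u)%N.
Proof.
elim/(@ptree_seq_ind (fun s => forall s', s' \in lgrafts u s ->
  sumn (map psize s') = (sumn (map psize s) + psize u)%N)): t t' => //.
- move=> s hs t'; rewrite graftsE inE => /orP[/eqP->|/mapP[s' /hs hs' ->]] /=.
    by rewrite addSn addnC.
  by rewrite hs'.
- move=> t s ht hs s' /=; rewrite mem_cat => /orP[] /mapP[x hx ->] /=.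
    by rewrite (ht _ hx) addnAC.
  by rewrite (hs _ hx) addnA.
Qed.

Section GraftSums.
Variable V : nmodType.
Implicit Types (phi : ptree -> V) (psi : seq ptree -> V).

Definition tinv phi := forall t t', tnorm t = tnorm t' -> phi t = phi t'.
Definition finv psi :=
  forall s s', perm_eq (map tnorm s) (map tnorm s') -> psi s = psi s'.

Lemma tinv_Node phi : tinv phi -> finv (fun s => phi (Node s)).
Proof. by move=> h s s' /tnorm_Node; apply: h. Qed.

Lemma finv_cons psi a : finv psi -> finv (fun s => psi (a :: s)).
Proof. by move=> h s s' hs; apply: h => /=; rewrite perm_cons. Qed.

Lemma finv_catl psi s1 : finv psi -> finv (fun s => psi (s1 ++ s)).
Proof. by move=> h s s' hs; apply: h; rewrite !map_cat perm_cat2l. Qed.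

Lemma finv_catr psi s1 : finv psi -> finv (fun s => psi (s ++ s1)).
Proof. by move=> h s s' hs; apply: h; rewrite !map_cat perm_cat2r. Qed.

Lemma finv_head psi s : finv psi -> tinv (fun a => psi (a :: s)).
Proof. by move=> h t t' htt'; apply: h => /=; rewrite htt'. Qed.

Lemma sum_grafts phi u s : \sum_(t <- grafts u (Node s)) phi t =
  phi (Node (u :: s)) + \sum_(s' <- lgrafts u s) phi (Node s').
Proof. by rewrite graftsE big_cons big_map. Qed.

Lemma sum_lgrafts psi u a s : \sum_(s' <- lgrafts u (a :: s)) psi s' =
  \sum_(a' <- grafts u a) psi (a' :: s) + \sum_(s' <- lgrafts u s) psi (a :: s').
Proof. by rewrite big_cat !big_map. Qed.

Lemma sum_lgrafts_cat psi u s1 s2 : \sum_(s' <- lgrafts u (s1 ++ s2)) psi s' =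
  \sum_(s' <- lgrafts u s1) psi (s' ++ s2) +
  \sum_(s' <- lgrafts u s2) psi (s1 ++ s').
Proof.
elim: s1 psi => [|a s1 IH] psi; first by rewrite /= big_nil add0r.
by rewrite cat_cons !sum_lgrafts IH addrA.
Qed.

Lemma sum_lgrafts_perm psi u s s' : finv psi -> perm_eq s s' ->
  \sum_(r <- lgrafts u s) psi r = \sum_(r <- lgrafts u s') psi r.
Proof.
move=> hpsi /catCA_perm_ind h.
apply: (h (fun s' => \sum_(r <- lgrafts u s) psi r =
                     \sum_(r <- lgrafts u s') psi r)) => // s1 s2 s3 ->.
rewrite !sum_lgrafts_cat [LHS]addrCA; congr (_ + (_ + _));
  apply: eq_bigr => r _; try rewrite !sum_lgrafts_cat;
  by apply: hpsi; rewrite !map_cat perm_catCA.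
Qed.

Lemma sum_grafts_tnorm phi u u' t t' : tinv phi ->
  tnorm u = tnorm u' -> tnorm t = tnorm t' ->
  \sum_(r <- grafts u t) phi r = \sum_(r <- grafts u' t') phi r.
Proof.
move=> hphi hu htt'.
suff H u0 v (psi : ptree -> V) : tinv psi -> \sum_(r <- grafts u0 v) psi r =
                     \sum_(r <- grafts (tnorm u0) (tnorm v)) psi r.
  by rewrite H // [RHS]H // hu htt'.
elim/(@ptree_seq_ind (fun s => forall psi, finv psi ->
  \sum_(r <- lgrafts u0 s) psi r =
  \sum_(r <- lgrafts (tnorm u0) (map tnorm s)) psi r)): v psi.
- move=> s hs {}psi hpsi; rewrite [tnorm (Node _)]/= !sum_grafts.
  have hN := tinv_Node hpsi.
  congr (_ + _).
    apply: hN => /=; rewrite tnorm_idem perm_cons perm_sym.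
    by rewrite -{2}(map_tnorm_idem s) perm_map // perm_sort.
  rewrite (hs _ hN); apply: sum_lgrafts_perm => //.
  by rewrite perm_sym perm_sort.
- by move=> psi _; rewrite !big_nil.
- move=> a s ha hs psi hpsi; rewrite map_cons !sum_lgrafts.
  rewrite (ha _ (finv_head s hpsi)) (hs _ (finv_cons a hpsi)).
  congr (_ + _); apply: eq_bigr => r _; apply: hpsi => /=.
    by rewrite perm_cons map_tnorm_idem.
  by rewrite tnorm_idem.
Qed.

End GraftSums.

Lemma prelie_arith1 (K : comRingType) (c g g' m m' x x' y y' : K) :
  x - y = x' - y' ->
  c + (g + m) + (m' + x) - (g + y) = c + (g' + m') + (m + x') - (g' + y').
Proof. by move=> h; have -> : x = x' - y' + y; [rewrite -h subrK | ring]. Qed.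

Lemma prelie_arith2 (K : comRingType) (m m' x x' y y' z z' w w' : K) :
  x - y = x' - y' -> z - w = z' - w' ->
  x + m + (m' + z) - (y + w) = x' + m' + (m + z') - (y' + w').
Proof.
move=> h h'; have -> : x = x' - y' + y by rewrite -h subrK.
by have -> : z = z' - w' + w; [rewrite -h' subrK | ring].
Qed.

Lemma grafts_prelie (K : comRingType) (phi : ptree -> K) (A B C : ptree) :
  tinv phi ->
  \sum_(t <- grafts B A) \sum_(u <- grafts C t) phi u -
  \sum_(t <- grafts C B) \sum_(u <- grafts t A) phi u =
  \sum_(t <- grafts C A) \sum_(u <- grafts B t) phi u -
  \sum_(t <- grafts B C) \sum_(u <- grafts t A) phi u.
Proof.
elim/(@ptree_seq_ind (fun s => forall psi : seq ptree -> K, finv psi ->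
  \sum_(t <- lgrafts B s) \sum_(u <- lgrafts C t) psi u -
  \sum_(t <- grafts C B) \sum_(u <- lgrafts t s) psi u =
  \sum_(t <- lgrafts C s) \sum_(u <- lgrafts B t) psi u -
  \sum_(t <- grafts B C) \sum_(u <- lgrafts t s) psi u)): A phi.
- move=> s hs phi hphi; have hN := tinv_Node hphi.
  pose c D E := phi (Node [:: E, D & s]).
  pose g D E := \sum_(t <- grafts E D) phi (Node (t :: s)).
  pose m D E := \sum_(t <- lgrafts E s) phi (Node (D :: t)).
  pose X D E := \sum_(t <- lgrafts D s) \sum_(u <- lgrafts E t) phi (Node u).
  pose Y D E := \sum_(t <- grafts E D) \sum_(u <- lgrafts t s) phi (Node u).
  have HX D E : \sum_(t <- grafts D (Node s)) \sum_(u <- grafts E t) phi u =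
      c D E + (g D E + m D E) + (m E D + X D E).
    rewrite !sum_grafts sum_lgrafts -big_split /=; congr (_ + _).
    by apply: eq_bigr => t _; rewrite sum_grafts.
  have HY D E : \sum_(t <- grafts E D) \sum_(u <- grafts t (Node s)) phi u =
      g D E + Y D E.
    by rewrite -big_split; apply: eq_bigr => t _; rewrite sum_grafts.
  have hc : c B C = c C B.
    apply: hN; rewrite !map_cons.
    exact: permEl (perm_catCA [:: tnorm C] [:: tnorm B] _).
  have h : X B C - Y B C = X C B - Y C B := hs _ hN.
  rewrite !HX !HY hc; clearbody c g m X Y.
  by apply: prelie_arith1.
- by move=> psi _; rewrite !big_nil !big1_seq // => t _; rewrite big_nil.
- move=> a s ha hs psi hpsi.
  pose X D E := \sum_(b <- grafts D a) \sum_(c <- grafts E b) psi (c :: s).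
  pose m D E := \sum_(b <- grafts D a) \sum_(t <- lgrafts E s) psi (b :: t).
  pose X' D E := \sum_(t <- lgrafts D s) \sum_(u <- lgrafts E t) psi (a :: u).
  pose Y D E := \sum_(t <- grafts E D) \sum_(b <- grafts t a) psi (b :: s).
  pose Y' D E := \sum_(t <- grafts E D) \sum_(u <- lgrafts t s) psi (a :: u).
  have HX D E : \sum_(t <- lgrafts D (a :: s)) \sum_(u <- lgrafts E t) psi u =
      X D E + m D E + (m E D + X' D E).
    rewrite sum_lgrafts [m E D]exchange_big -!big_split /=.
    by congr (_ + _); apply: eq_bigr => t _; rewrite sum_lgrafts.
  have HY D E : \sum_(t <- grafts E D) \sum_(u <- lgrafts t (a :: s)) psi u =
      Y D E + Y' D E.
    by rewrite -big_split; apply: eq_bigr => t _; rewrite sum_lgrafts.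
  have h : X B C - Y B C = X C B - Y C B := ha _ (finv_head s hpsi).
  have h' : X' B C - Y' B C = X' C B - Y' C B := hs _ (finv_cons a hpsi).
  rewrite !HX !HY; clearbody m X Y X' Y'.
  by apply: prelie_arith2.
Qed.

(* The isomorphism classes of rooted trees with at most n vertices; grafting  *)
(* a new leaf on the trees with at most n vertices reaches all the trees with *)
(* between 2 and n + 1 vertices.                                              *)
Fixpoint trees_le (n : nat) : seq rtree :=
  if n is m.+1 then
    undup (bullet :: [seq tclass t | T <- trees_le m, t <- grafts leaf (ptree_of T)])
  else [::].

Lemma psize_gt0 t : (0 < psize t)%N. Proof. by case: t. Qed.

Lemma grow t : (1 < psize t)%N ->
  exists t0, exists2 u, u \in grafts leaf t0 & tnorm u = tnorm t.
Proof.
elim/(@ptree_seq_ind (fun s => (0 < size s)%N -> exists t0,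
  exists2 u, u \in grafts leaf t0 & tnorm u = tnorm (Node s))): t => //.
- by move=> [|a s] hs // _; apply: hs.
- move=> a s ha _ _; case: (ltnP 1 (psize a)) => [/ha[t0 [u hu hua]]|].
    exists (Node (t0 :: s)), (Node (u :: s)); last first.
      by apply/tnorm_Node; rewrite /= hua.
    rewrite graftsE inE; apply/orP; right; apply: map_f.
    by rewrite mem_cat map_f.
  case: a {ha} => [[|b r]] /= ha; first by exists (Node s), (Node (leaf :: s)); rewrite ?mem_head.
  by have := psize_gt0 b; case: (psize b) ha.
Qed.

Lemma uniq_trees_le n : uniq (trees_le n).
Proof. by case: n => // n; exact: undup_uniq. Qed.

Lemma trees_leS n : trees_le n.+1 =
  undup (bullet :: [seq tclass t | T <- trees_le n, t <- grafts leaf (ptree_of T)]).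
Proof. by []. Qed.

Lemma count_grafts_tnorm (P : pred rtree) u u' t t' :
  tnorm u = tnorm u' -> tnorm t = tnorm t' ->
  count (fun r => P (tclass r)) (grafts u t) =
  count (fun r => P (tclass r)) (grafts u' t').
Proof.
move=> hu ht; pose phi r := if P (tclass r) then 1%N else 0%N.
have hphi : @tinv nat phi by move=> r r' /tnorm_iso/tclassP h; rewrite /phi h.
have := sum_grafts_tnorm hphi hu ht.
by rewrite /phi -!big_mkcond !sum1_count.
Qed.

Lemma mem_trees_le n T : (T \in trees_le n) = (rsize T <= n)%N.
Proof.
elim: n T => [|n IH] T; first by rewrite leqNgt psize_gt0.
rewrite trees_leS mem_undup inE; apply/idP/idP.
  case/orP => [/eqP->|/allpairsPdep[S [t [hS ht ->]]]].
    by rewrite rsize_tclass.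
  by rewrite rsize_tclass (psize_grafts ht) addn1 ltnS -/(rsize S) -IH.
move=> hT; case: (ltnP 1 (rsize T)) => h1; last first.
  apply/orP; left; apply/eqP; rewrite -[T]ptree_ofK; congr tclass.
  move: h1; rewrite /rsize; case: (ptree_of T) => [[|b r]] //=.
  by have := psize_gt0 b; case: (psize b).
apply/orP; right; have [t0 [u hu hut]] := grow h1.
have hT0 : (psize t0 <= n)%N.
  rewrite -ltnS -addn1 -[1%N]/(psize leaf) -(psize_grafts hu).
  by rewrite -psize_tnorm hut psize_tnorm.
have : has (fun r => tclass r == T) (grafts leaf t0).
  apply/hasP; exists u => //; apply/eqP; rewrite -[RHS]ptree_ofK.
  exact/tclassP/tnorm_iso.
rewrite has_count (count_grafts_tnorm (pred1 T) (erefl _) (esym (tnorm_idem t0))).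
rewrite -has_count => /hasP[r hr /eqP <-].
apply/allpairsPdep; exists (tclass t0), r; split=> //.
by rewrite IH rsize_tclass.
Qed.

Definition ngraft (A B S : rtree) : nat :=
  count (fun t => tclass t == S) (grafts (ptree_of B) (ptree_of A)).

Lemma ngraft_size A B S : ngraft A B S != 0%N -> rsize S = (rsize A + rsize B)%N.
Proof.
rewrite -lt0n -has_count => /hasP[t ht /eqP <-].
by rewrite rsize_tclass (psize_grafts ht).
Qed.

Lemma big_uniq_eq (K : nmodType) (I : eqType) (r1 r2 : seq I) (F : I -> K) :
  uniq r1 -> uniq r2 -> (forall i, F i != 0 -> (i \in r1) = (i \in r2)) ->
  \sum_(i <- r1) F i = \sum_(i <- r2) F i.
Proof.
move=> u1 u2 h; pose P i := F i != 0.
have E r : \sum_(i <- r) F i = \sum_(i <- [seq i <- r | P i]) F i.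
  rewrite big_filter [RHS]big_mkcond; apply: eq_bigr => i _.
  by rewrite /P; case: eqP => //= ->.
rewrite E [RHS]E; apply: perm_big; apply: uniq_perm; rewrite ?filter_uniq // => i.
by rewrite !mem_filter; case: (boolP (P i)) => //= /h ->.
Qed.

Lemma fsubE (I : Type) (V : zmodType) (f g : I -> V) i : (f - g) i = f i - g i.
Proof. by []. Qed.

Lemma faddE (I : Type) (V : nmodType) (f g : I -> V) i : (f + g) i = f i + g i.
Proof. by []. Qed.

(* The completion of PL: the series a, written in the basis of rooted trees,  *)
(* has coefficient a T on the tree T.                                         *)
Notation plhat K := (rtree -> K).

Section PreLie.
Variable K : fieldType.
Implicit Types (a b x y : plhat K) (A B C S T : rtree).

Definition tree A : plhat K := fun S => (S == A)%:R.

(* Bilinear and continuous extension of the grafting product of trees. Only   *)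
(* the trees A and B with rsize A + rsize B = rsize T contribute.             *)
Definition prelie a b : plhat K := fun T =>
  \sum_(A <- trees_le (rsize T)) \sum_(B <- trees_le (rsize T))
    a A * b B * (ngraft A B T)%:R.

Lemma sum_trees_le n m (f : rtree -> K) :
  (forall S, f S != 0 -> (rsize S <= n)%N) -> (n <= m)%N ->
  \sum_(S <- trees_le n) f S = \sum_(S <- trees_le m) f S.
Proof.
move=> hf nm; apply: big_uniq_eq; rewrite ?uniq_trees_le // => S /hf hS.
by rewrite !mem_trees_le hS (leq_trans hS nm).
Qed.

Lemma ngraft_neq0 A B S (c : K) : c * (ngraft A B S)%:R != 0 ->
  rsize S = (rsize A + rsize B)%N.
Proof.
move=> h; apply: ngraft_size; apply: contraNneq h => ->.
by rewrite mulr0.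
Qed.

Lemma prelieE m a b T : (rsize T <= m)%N -> prelie a b T =
  \sum_(A <- trees_le m) \sum_(B <- trees_le m) a A * b B * (ngraft A B T)%:R.
Proof.
move=> hm; rewrite /prelie (@sum_trees_le _ m) //.
  apply: eq_bigr => A _; apply: sum_trees_le => // B /ngraft_neq0 ->.
  exact: leq_addl.
move=> A; apply: contraNleq => hA; rewrite big1 // => B _.
apply/eqP/negP => /negP/ngraft_neq0 hT; move: hA.
by rewrite hT ltnNge leq_addr.
Qed.

Lemma prelie_local y y' a T :
  (forall S, (rsize S < rsize T)%N -> y S = y' S) ->
  prelie y a T = prelie y' a T.
Proof.
move=> h; apply: eq_bigr => A _; apply: eq_bigr => B _.
have [hA|hA] := boolP (ngraft A B T == 0%N); first by rewrite (eqP hA) !mulr0.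
by rewrite h // (ngraft_size hA) -addn1 leq_add2l psize_gt0.
Qed.

Lemma prelie_linear (I : Type) (r : seq I) (c : I -> K) (y : I -> plhat K) a T :
  prelie (fun S => \sum_(i <- r) c i * y i S) a T =
  \sum_(i <- r) c i * prelie (y i) a T.
Proof.
rewrite /prelie; under [RHS]eq_bigr do rewrite mulr_sumr.
rewrite [RHS]exchange_big; apply: eq_bigr => A _ /=.
under [RHS]eq_bigr do rewrite mulr_sumr.
rewrite [RHS]exchange_big; apply: eq_bigr => B _ /=.
by rewrite !mulr_suml; apply: eq_bigr => i _; rewrite !mulrA.
Qed.

Lemma prelieBr x a b : prelie x (a - b) = prelie x a - prelie x b.
Proof.
apply/funext => T; rewrite fsubE /prelie -sumrB; apply: eq_bigr => A _.
rewrite -sumrB; apply: eq_bigr => B _.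
by rewrite fsubE mulrBr mulrBl.
Qed.

Lemma prelie0l a : prelie 0 a = 0.
Proof.
apply/funext => T; rewrite /prelie big1 // => A _; rewrite big1 // => B _.
by rewrite !mul0r.
Qed.

Lemma prelie_treer m x A T : (rsize T <= m)%N -> (rsize A <= m)%N ->
  prelie x (tree A) T = \sum_(B <- trees_le m) x B * (ngraft B A T)%:R.
Proof.
move=> hT hA; rewrite (prelieE _ _ hT); apply: eq_bigr => B _.
rewrite (bigD1_seq A) ?uniq_trees_le ?mem_trees_le //= /tree eqxx mulr1.
by rewrite big1 ?addr0 // => C /negPf ->; rewrite mulr0 mul0r.
Qed.

Lemma sum_ngraft m (f : rtree -> K) A B :
  (forall S, f S != 0 -> (rsize S <= m)%N) ->
  \sum_(S <- trees_le m) (ngraft A B S)%:R * f S =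
  \sum_(t <- grafts (ptree_of B) (ptree_of A)) f (tclass t).
Proof.
move=> hf; transitivity (\sum_(S <- trees_le m)
  \sum_(t <- grafts (ptree_of B) (ptree_of A)) (tclass t == S)%:R * f S).
  apply: eq_bigr => S _; rewrite -mulr_suml -natr_sum; congr (_%:R * _).
  by rewrite /ngraft -sum1_count big_mkcond; apply: eq_bigr => t _; case: eqP.
rewrite exchange_big; apply: eq_bigr => t _ /=.
have [ht|ht] := boolP (tclass t \in trees_le m).
  rewrite (bigD1_seq (tclass t)) ?uniq_trees_le //= eqxx mul1r.
  by rewrite big1 ?addr0 // => S; rewrite eq_sym => /negPf ->; rewrite mul0r.
have f0 : f (tclass t) = 0.
  by apply/eqP; apply: contraNT ht => /hf; rewrite mem_trees_le.
by rewrite big1 ?f0 // => S _; case: eqP => [<-|]; rewrite ?f0 ?mulr0 ?mul0r.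
Qed.

Lemma ngraft_sum A B T :
  (ngraft A B T)%:R = \sum_(t <- grafts (ptree_of B) (ptree_of A)) (tclass t == T)%:R :> K.
Proof.
by rewrite -natr_sum /ngraft -sum1_count big_mkcond; congr (_%:R).
Qed.

Lemma tinv_tclass (f : rtree -> K) : tinv (fun t => f (tclass t)).
Proof. by move=> t t' /tnorm_iso/tclassP ->. Qed.

Lemma ngraft_prelie m A B C T : (rsize T <= m)%N ->
  let n A B S : K := (ngraft A B S)%:R in
  let asc B C := \sum_(S <- trees_le m) n A B S * n S C T -
                 \sum_(S <- trees_le m) n B C S * n A S T in
  asc B C = asc C B.
Proof.
move=> hT n asc; pose phi t : K := (tclass t == T)%:R.
have hphi : tinv phi := tinv_tclass (fun S => (S == T)%:R).
suff E D E : asc D E =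
  \sum_(t <- grafts D A) \sum_(u <- grafts E t) phi u -
  \sum_(t <- grafts E D) \sum_(u <- grafts t A) phi u.
  by rewrite !E; apply: grafts_prelie.
rewrite /asc !sum_ngraft.
- congr (_ - _); apply: eq_bigr => t _; rewrite /n ngraft_sum;
    by apply: sum_grafts_tnorm => //; exact: tnorm_idem.
- move=> S; rewrite /n -[X in X != _]mul1r => /ngraft_neq0 hS.
  by apply: leq_trans hT; rewrite hS leq_addl.
- move=> S; rewrite /n -[X in X != _]mul1r => /ngraft_neq0 hS.
  by apply: leq_trans hT; rewrite hS leq_addr.
Qed.

Lemma prelie_prelie m x a b T : (rsize T <= m)%N ->
  prelie (prelie x a) b T =
  \sum_(A <- trees_le m) \sum_(B <- trees_le m) \sum_(C <- trees_le m)
    x A * a B * b C *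
    \sum_(S <- trees_le m) (ngraft A B S)%:R * (ngraft S C T)%:R.
Proof.
move=> hT; rewrite (prelieE _ _ hT).
under eq_big_seq => S hS.
  under eq_bigr => C _.
    rewrite (@prelieE m); last by rewrite -mem_trees_le.
    rewrite !mulr_suml; under eq_bigr do rewrite !mulr_suml.
    over.
  over.
rewrite /=.
under eq_bigr => S _ do rewrite exchange_big /=.
rewrite exchange_big; apply: eq_bigr => A _ /=.
under eq_bigr => S _ do rewrite exchange_big /=.
rewrite exchange_big; apply: eq_bigr => B _ /=.
rewrite exchange_big; apply: eq_bigr => C _ /=.
by rewrite mulr_sumr; apply: eq_bigr => S _; ring.
Qed.

Lemma prelie_prelier m x a b T : (rsize T <= m)%N ->
  prelie x (prelie a b) T =
  \sum_(A <- trees_le m) \sum_(B <- trees_le m) \sum_(C <- trees_le m)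
    x A * a B * b C *
    \sum_(S <- trees_le m) (ngraft B C S)%:R * (ngraft A S T)%:R.
Proof.
move=> hT; rewrite (prelieE _ _ hT); apply: eq_bigr => A _.
under eq_big_seq => S hS.
  rewrite (@prelieE m); last by rewrite -mem_trees_le.
  rewrite mulr_sumr mulr_suml; under eq_bigr do rewrite mulr_sumr mulr_suml.
  over.
rewrite exchange_big; apply: eq_bigr => B _ /=.
rewrite exchange_big; apply: eq_bigr => C _ /=.
by rewrite mulr_sumr; apply: eq_bigr => S _; ring.
Qed.

Lemma prelieP x a b :
  prelie (prelie x a) b - prelie x (prelie a b) =
  prelie (prelie x b) a - prelie x (prelie b a).
Proof.
apply/funext => T; rewrite !fsubE.
rewrite !(prelie_prelie _ _ _ (leqnn _)) !(prelie_prelier _ _ _ (leqnn _)).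
rewrite -!sumrB; apply: eq_bigr => A _; rewrite -!sumrB.
under eq_bigr do rewrite -sumrB.
under [RHS]eq_bigr do rewrite -sumrB.
rewrite exchange_big; apply: eq_bigr => B _; apply: eq_bigr => C _ /=.
rewrite -!mulrBr (ngraft_prelie A C B (leqnn (rsize T))).
by congr (_ * _); ring.
Qed.

Definition plbracket a b := prelie a b - prelie b a.

End PreLie.

(* The degree-completed tensor algebra of PL: formal series over words of     *)
(* rooted trees (the word of trees A1 ... Ak is the tensor A1 (x) ... (x) Ak).*)
Notation tenshat K := (seq rtree -> K).

Definition weight (w : seq rtree) : nat := sumn (map rsize w).

Lemma weight_cat u v : weight (u ++ v) = (weight u + weight v)%N.
Proof. by rewrite /weight map_cat sumn_cat. Qed.

Lemma weight_take i w : (weight (take i w) <= weight w)%N.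
Proof. by rewrite -{2}(cat_take_drop i w) weight_cat leq_addr. Qed.

Lemma weight_drop i w : (weight (drop i w) <= weight w)%N.
Proof. by rewrite -{2}(cat_take_drop i w) weight_cat leq_addl. Qed.

Lemma size_weight w : (size w <= weight w)%N.
Proof.
elim: w => // A w IH; exact: (leq_add (psize_gt0 A) IH).
Qed.

(* The words of length at most k in trees with at most n vertices.            *)
Fixpoint words (n k : nat) : seq (seq rtree) :=
  if k is k'.+1 then [::] :: [seq A :: w | A <- trees_le n, w <- words n k']
  else [:: [::]].

Lemma mem_words n k w :
  (w \in words n k) = (size w <= k)%N && all (fun A => rsize A <= n)%N w.
Proof.
elim: k w => [|k IH] [|A w] //=; rewrite inE /=.
apply/allpairsP/idP => [[[B v] /= [hB hv [-> ->]]]|].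
  by move: hv; rewrite IH ltnS => /andP[-> ->]; rewrite -mem_trees_le hB.
rewrite ltnS andbCA => /andP[hA hw]; exists (A, w) => /=.
by rewrite mem_trees_le hA IH hw.
Qed.

Lemma uniq_words n k : uniq (words n k).
Proof.
elim: k => //= k IH; apply/andP; split; first by apply/allpairsP => -[[]] ? ? [].
by apply: allpairs_uniq => //; [exact: uniq_trees_le | move=> [? ?] [? ?] _ _ [-> ->]].
Qed.

Lemma words_weight n w : (weight w <= n)%N -> w \in words n n.
Proof.
move=> hw; rewrite mem_words (leq_trans (size_weight w) hw) /=.
apply/allP => A hA; apply: leq_trans hw.
by case/splitPr: hA => u v; rewrite weight_cat /weight /= addnCA leq_addr.
Qed.

Section Tensor.
Variable K : fieldType.
Implicit Types (a b x y : plhat K) (f g h : tenshat K) (w u v : seq rtree).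

Definition tmul f g : tenshat K := fun w =>
  \sum_(i < (size w).+1) f (take i w) * g (drop i w).

Definition tone : tenshat K := fun w => (w == [::])%:R.

Definition tincl a : tenshat K := fun w => if w is [:: A] then a A else 0.

Definition tpow f k : tenshat K := iter k (tmul^~ f) tone.

Lemma tmul_nil f g : tmul f g [::] = f [::] * g [::].
Proof. by rewrite /tmul big_ord_recl big_ord0 addr0. Qed.

Lemma tmul_cons f g A w :
  tmul f g (A :: w) = f [::] * g (A :: w) + tmul (fun u => f (A :: u)) g w.
Proof. by rewrite /tmul big_ord_recl. Qed.

Lemma tmulDl f f' g : tmul (f + f') g = tmul f g + tmul f' g.
Proof.
apply/funext => w; rewrite faddE -big_split; apply: eq_bigr => i _.
by rewrite faddE mulrDl.
Qed.

Lemma tmulBl f f' g : tmul (f - f') g = tmul f g - tmul f' g.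
Proof.
apply/funext => w; rewrite fsubE -sumrB; apply: eq_bigr => i _.
by rewrite fsubE mulrBl.
Qed.

Lemma tmulBr f g g' : tmul f (g - g') = tmul f g - tmul f g'.
Proof.
apply/funext => w; rewrite fsubE -sumrB; apply: eq_bigr => i _.
by rewrite fsubE mulrBr.
Qed.

Lemma tmulA f g h : tmul f (tmul g h) = tmul (tmul f g) h.
Proof.
apply/funext => w; elim: w f g h => [|A w IH] f g h.
  by rewrite !tmul_nil mulrA.
rewrite !tmul_cons tmul_nil IH mulrDr mulrA -addrA; congr (_ + _).
have -> : (fun u => tmul f g (A :: u)) =
  (fun u => f [::] * g (A :: u)) + tmul (fun u => f (A :: u)) g.
  by apply/funext => u; rewrite tmul_cons faddE.
rewrite tmulDl faddE; congr (_ + _).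
by rewrite /tmul mulr_sumr; apply: eq_bigr => i _; rewrite mulrA.
Qed.

Lemma tmul1l f : tmul tone f = f.
Proof.
apply/funext => -[|A w]; first by rewrite tmul_nil /tone eqxx mul1r.
rewrite tmul_cons /tone eqxx mul1r /tmul big1 ?addr0 // => i _.
by rewrite mul0r.
Qed.

Lemma tmul1r f : tmul f tone = f.
Proof.
apply/funext => w; elim: w f => [|A w IH] f; first by rewrite tmul_nil mulr1.
by rewrite tmul_cons IH mulr0 add0r.
Qed.

(* The right action on completed PL of the completed tensor algebra: a word   *)
(* A1 ... Ak acts by A1, then A2, ..., then Ak. Only the words of weight less *)
(* than rsize T contribute to the coefficient of T (wact_size), and they all  *)
(* belong to words (rsize T) (rsize T).                                       *)
Definition wact x w : plhat K := foldl (fun y A => prelie y (tree K A)) x w.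

Definition tact x f : plhat K := fun T =>
  \sum_(w <- words (rsize T) (rsize T)) f w * wact x w T.

Lemma wact_rcons x w A : wact x (rcons w A) = prelie (wact x w) (tree K A).
Proof. by rewrite /wact -cats1 foldl_cat. Qed.

Lemma wact_cat x u v : wact x (u ++ v) = wact (wact x u) v.
Proof. by rewrite /wact foldl_cat. Qed.

Lemma wact_size x w T : wact x w T != 0 -> (weight w < rsize T)%N.
Proof.
elim/last_ind: w T => [|w A IH] T; first by rewrite psize_gt0.
rewrite wact_rcons -cats1 weight_cat /weight /= addn0 => h.
case: (leqP (rsize A) (rsize T)) => hA; last first.
  case/eqP: h; rewrite /prelie big1_seq // => B _; rewrite big1_seq // => C.
  rewrite mem_trees_le => hC; rewrite /tree.
  by have /negPf -> : C != A; [apply: contraTneq hC => ->; rewrite -ltnNge | rewrite mulr0 mul0r].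
rewrite (prelie_treer _ (leqnn _) hA) in h.
rewrite ltnNge; apply/negP => hT; case/eqP: h; rewrite big1_seq // => B _.
apply/eqP/negP => /negP h; have hB := ngraft_neq0 h.
have /IH : wact x w B != 0 by apply: contraNneq h => ->; rewrite mul0r.
by move: hT; rewrite hB leq_add2r ltnNge => ->.
Qed.

Lemma wact_local y y' w T :
  (forall S, (rsize S <= rsize T)%N -> y S = y' S) -> wact y w T = wact y' w T.
Proof.
elim/last_ind: w T => [|w A IH] T h; first exact: h.
rewrite !wact_rcons; apply: prelie_local => S hS; apply: IH => R hR.
by apply: h; apply: leq_trans hR (ltnW hS).
Qed.

Lemma wact_linear (I : Type) (r : seq I) (c : I -> K) (y : I -> plhat K) w T :
  wact (fun S => \sum_(i <- r) c i * y i S) w T =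
  \sum_(i <- r) c i * wact (y i) w T.
Proof.
elim/last_ind: w T => [|w A IH] T //.
rewrite wact_rcons; under [RHS]eq_bigr do rewrite wact_rcons.
by rewrite -prelie_linear; apply: prelie_local => S _; rewrite IH.
Qed.

Lemma tactE m x f T : (rsize T <= m)%N ->
  tact x f T = \sum_(w <- words m m) f w * wact x w T.
Proof.
move=> hT; apply: big_uniq_eq; rewrite ?uniq_words // => w h.
have /wact_size/ltnW hw : wact x w T != 0.
  by apply: contraNneq h => ->; rewrite mulr0.
by rewrite !words_weight // (leq_trans hw).
Qed.

Lemma tact_local x f g T :
  (forall w, (weight w < rsize T)%N -> f w = g w) -> tact x f T = tact x g T.
Proof.
move=> h; apply: eq_bigr => w _.
have [->|/wact_size/h -> //] := eqVneq (wact x w T) 0; by rewrite !mulr0.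
Qed.

Lemma tact0l f : tact 0 f = 0.
Proof.
apply/funext => T; rewrite /tact big1 // => w _.
suff -> : wact 0 w = 0 by rewrite mulr0.
by elim/last_ind: w => // w A IH; rewrite wact_rcons IH prelie0l.
Qed.

Lemma tact0r x : tact x 0 = 0.
Proof. by apply/funext => T; rewrite /tact big1 // => w _; rewrite mul0r. Qed.

Lemma tactBr x f g : tact x (f - g) = tact x f - tact x g.
Proof.
apply/funext => T; rewrite fsubE -sumrB; apply: eq_bigr => w _.
by rewrite fsubE mulrBl.
Qed.

Lemma tact_sum x (I : Type) (r : seq I) (c : I -> K) (f : I -> tenshat K) T :
  tact x (fun w => \sum_(i <- r) c i * f i w) T = \sum_(i <- r) c i * tact x (f i) T.
Proof.
rewrite /tact; under [RHS]eq_bigr do rewrite mulr_sumr.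
rewrite [RHS]exchange_big; apply: eq_bigr => w _ /=.
by rewrite mulr_suml; apply: eq_bigr => i _; rewrite mulrA.
Qed.

Lemma tact1 x : tact x tone = x.
Proof.
apply/funext => T; rewrite /tact (bigD1_seq [::]) ?uniq_words ?words_weight //=.
by rewrite mul1r big1 ?addr0 // => w; rewrite /tone => /negPf ->; rewrite mul0r.
Qed.

Lemma tact_incl x a : tact x (tincl a) = prelie x a.
Proof.
apply/funext => T; transitivity (\sum_(w <- [seq [:: A] | A <- trees_le (rsize T)])
    tincl a w * wact x w T).
  apply: big_uniq_eq; rewrite ?uniq_words ?map_inj_uniq ?uniq_trees_le //.
    by move=> A B [].
  case=> [|A [|B w]] h; try by rewrite mul0r eqxx in h.
  have /wact_size/ltnW hw : wact x [:: A] T != 0.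
    by apply: contraNneq h => ->; rewrite mulr0.
  rewrite words_weight // mem_map; last by move=> ? ? [].
  by move: hw; rewrite /weight /= addn0 mem_trees_le => ->.
rewrite big_map /prelie exchange_big; apply: eq_big_seq => A.
rewrite mem_trees_le => hA /=; rewrite (prelie_treer _ (leqnn _) hA) mulr_sumr.
by apply: eq_bigr => B _; rewrite mulrA [a A * _]mulrC.
Qed.

Lemma sum_words_split n (F : seq rtree -> seq rtree -> K) :
  (forall u v, F u v != 0 -> (weight (u ++ v) <= n)%N) ->
  \sum_(w <- words n n) \sum_(i < (size w).+1) F (take i w) (drop i w) =
  \sum_(u <- words n n) \sum_(v <- words n n) F u v.
Proof.
move=> hF; pose F' (p : seq rtree * seq rtree) := F p.1 p.2.
transitivity (\sum_(p <- [seq (take i w, drop i w)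
    | w <- words n n, i <- iota 0 (size w).+1]) F' p).
  rewrite big_allpairs_dep; apply: eq_bigr => w _.
  by rewrite -(big_mkord xpredT (fun i => F (take i w) (drop i w))) /index_iota subn0.
transitivity (\sum_(p <- [seq (u, v) | u <- words n n, v <- words n n]) F' p);
  last by rewrite big_allpairs.
apply: big_uniq_eq.
- apply: allpairs_uniq_dep; rewrite ?uniq_words //.
    by move=> w _; apply: iota_uniq.
  move=> [w i] [w' i'] /allpairsPdep[w1 [i1 [_ hi [-> ->]]]].
  case/allpairsPdep=> [w2 [i2 [_ hi' [-> ->]]]] /= [ht hd].
  have hw : w1 = w2 by rewrite -(cat_take_drop i1 w1) ht hd cat_take_drop.
  move: hi hi'; rewrite !mem_iota !ltnS /= => hi hi'.
  by have := congr1 size ht; rewrite !size_takel // hw => ->.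
- by apply: allpairs_uniq; rewrite ?uniq_words // => -[? ?] [? ?] _ _ [-> ->].
- move=> [u v] h; have huv : (weight (u ++ v) <= n)%N := hF u v h.
  have := huv; rewrite weight_cat => huv'.
  have hu := leq_trans (leq_addr _ _) huv'; have hv := leq_trans (leq_addl _ _) huv'.
  transitivity true; last first.
    by apply/esym/allpairsP; exists (u, v); rewrite !words_weight.
  apply/allpairsPdep; exists (u ++ v), (size u); rewrite words_weight //.
  by rewrite mem_iota size_cat /= add0n ltnS leq_addr take_size_cat ?drop_size_cat.
Qed.

Lemma tact_mul x f g : tact x (tmul f g) = tact (tact x f) g.
Proof.
apply/funext => T; set n := rsize T.
transitivity (\sum_(u <- words n n) \sum_(v <- words n n)
   f u * g v * wact x (u ++ v) T).
  rewrite -(@sum_words_split n (fun u v => f u * g v * wact x (u ++ v) T)).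
    apply: eq_bigr => w _; rewrite mulr_suml; apply: eq_bigr => i _.
    by rewrite cat_take_drop.
  move=> u v h; apply: ltnW; apply: (@wact_size x).
  by apply: contraNneq h => ->; rewrite mulr0.
rewrite exchange_big; apply: eq_bigr => v _ /=.
rewrite (@wact_local _ (fun S => \sum_(u <- words n n) f u * wact x u S)).
  rewrite wact_linear mulr_sumr; apply: eq_bigr => u _.
  by rewrite wact_cat; ring.
by move=> S hS; rewrite (tactE _ _ hS).
Qed.

Lemma tact_pow x a k : tact x (tpow (tincl a) k) = iter k (fun y => prelie y a) x.
Proof.
elim: k => [|k IH]; first exact: tact1.
by rewrite /tpow iterS tact_mul -/(tpow _ _) tact_incl IH.
Qed.

(* The two-sided ideal generated by the a (x) b - b (x) a - [a, b], and its   *)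
(* closure for the topology given by the weight.                              *)
Inductive uideal : tenshat K -> Prop :=
| uideal_gen a b : uideal
    (tmul (tincl a) (tincl b) - tmul (tincl b) (tincl a) - tincl (plbracket a b))
| uideal_zero : uideal 0
| uideal_sub f g : uideal f -> uideal g -> uideal (f - g)
| uideal_mul f g h : uideal g -> uideal (tmul f (tmul g h)).

Definition uideal_closure f : Prop := forall n, exists2 g, uideal g &
  forall w, (weight w <= n)%N -> f w = g w.

Lemma tact_uideal x f : uideal f -> tact x f = 0.
Proof.
move=> hf; elim: hf x => {f}.
- move=> a b x; rewrite !tactBr !tact_mul !tact_incl /plbracket prelieBr.
  have h := prelieP x a b; apply/funext => T.
  have hT := congr1 (fun y : plhat K => y T) h; rewrite /= !fsubE in hT.
  rewrite !fsubE -[X in X - _ - _](subrK (prelie x (prelie a b) T)) hT.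
  by rewrite -[RHS]/(0 : K); ring.
- by move=> x; rewrite tact0r.
- by move=> f g _ hf _ hg x; rewrite tactBr hf hg subrr.
- by move=> f g h _ hg x; rewrite !tact_mul hg tact0l.
Qed.

Lemma tact_closure x f : uideal_closure f -> tact x f = 0.
Proof.
move=> hf; apply/funext => T; have [g hg hfg] := hf (rsize T).
rewrite (@tact_local _ _ g) ?tact_uideal // => w hw; exact/hfg/ltnW.
Qed.

Lemma closure0 : uideal_closure 0.
Proof. by move=> n; exists 0 => //; exact: uideal_zero. Qed.

Lemma closureB f g : uideal_closure f -> uideal_closure g -> uideal_closure (f - g).
Proof.
move=> hf hg n; have [f' hf' ff'] := hf n; have [g' hg' gg'] := hg n.
exists (f' - g'); first exact: uideal_sub.
by move=> w hw; rewrite !fsubE ff' ?gg'.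
Qed.

Lemma closureMl f g : uideal_closure g -> uideal_closure (tmul f g).
Proof.
move=> hg n; have [g' hg' gg'] := hg n; exists (tmul f g').
  by rewrite -[g']tmul1r; apply: uideal_mul.
move=> w hw; apply: eq_bigr => i _; rewrite gg' //.
exact: leq_trans (weight_drop _ _) hw.
Qed.

Lemma closureMr f g : uideal_closure f -> uideal_closure (tmul f g).
Proof.
move=> hf n; have [f' hf' ff'] := hf n; exists (tmul f' g).
  by rewrite -[tmul _ _]tmul1l; apply: uideal_mul.
move=> w hw; apply: eq_bigr => i _; rewrite ff' //.
exact: leq_trans (weight_take _ _) hw.
Qed.

Definition uclosure : {pred tenshat K} := fun f => `[< uideal_closure f >].

Lemma uclosure_zmod : zmod_closed uclosure.
Proof.
split=> [|f g /asboolP hf /asboolP hg]; apply/asboolP; first exact: closure0.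
exact: closureB.
Qed.

HB.instance Definition _ := GRing.isZmodClosed.Build (tenshat K) uclosure uclosure_zmod.

(* The degree-completed universal enveloping algebra of the Lie algebra PL.   *)
Definition uenvhat := {ideal_quot uclosure}.

HB.instance Definition _ := GRing.Zmodule.on uenvhat.

Definition uclass f : uenvhat := \pi_uenvhat f.

Lemma uclass_eq f g : uclass f = uclass g <-> uideal_closure (f - g).
Proof.
split=> [/eqP|h]; first by rewrite -Quotient.idealrBE => /asboolP.
by apply/eqP; rewrite -Quotient.idealrBE; apply/asboolP.
Qed.

Lemma uclass_repr (u : uenvhat) : uclass (repr u) = u.
Proof. exact: reprK. Qed.

Lemma uclassB f g : uclass (f - g) = uclass f - uclass g.
Proof. by rewrite /uclass !piE. Qed.

Definition uone : uenvhat := uclass tone.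

Definition ustar (u v : uenvhat) : uenvhat := uclass (tmul (repr u) (repr v)).

Definition uact x (u : uenvhat) : plhat K := tact x (repr u).

Lemma ustarE f g : ustar (uclass f) (uclass g) = uclass (tmul f g).
Proof.
set f' := repr (uclass f); set g' := repr (uclass g).
have hf : uideal_closure (f' - f) by apply/uclass_eq; rewrite uclass_repr.
have hg : uideal_closure (g' - g) by apply/uclass_eq; rewrite uclass_repr.
apply/uclass_eq; rewrite -/f' -/g'.
rewrite -[_ - _](subrKA (tmul f' g)) -tmulBr -tmulBl -[X in _ + X]opprK.
by apply: closureB; [exact: closureMl | rewrite -[- _]sub0r; apply: closureB;
  [exact: closure0 | exact: closureMr]].
Qed.

Lemma ustarA : associative ustar.
Proof.
move=> u v w; rewrite -[u]uclass_repr -[v]uclass_repr -[w]uclass_repr.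
by rewrite !ustarE tmulA.
Qed.

Lemma ustar1l : left_id uone ustar.
Proof. by move=> u; rewrite -[u]uclass_repr ustarE tmul1l. Qed.

Lemma ustar1r : right_id uone ustar.
Proof. by move=> u; rewrite -[u]uclass_repr ustarE tmul1r. Qed.

Lemma ustar_bracket a b :
  ustar (uclass (tincl a)) (uclass (tincl b)) -
  ustar (uclass (tincl b)) (uclass (tincl a)) = uclass (tincl (plbracket a b)).
Proof.
rewrite !ustarE -uclassB; apply/uclass_eq => n.
by exists (tmul (tincl a) (tincl b) - tmul (tincl b) (tincl a) -
           tincl (plbracket a b)) => //; exact: uideal_gen.
Qed.

Lemma uactE x f : uact x (uclass f) = tact x f.
Proof.
apply/eqP; rewrite -subr_eq0 -tactBr; apply/eqP/tact_closure/uclass_eq.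
exact: uclass_repr.
Qed.

Lemma uactB x (u v : uenvhat) : uact x (u - v) = uact x u - uact x v.
Proof.
by rewrite -[u]uclass_repr -[v]uclass_repr -uclassB !uactE tactBr.
Qed.

Lemma uact_incl x a : uact x (uclass (tincl a)) = prelie x a.
Proof. by rewrite uactE tact_incl. Qed.

Lemma uact1 x : uact x uone = x.
Proof. by rewrite uactE tact1. Qed.

Lemma uact_star x (u v : uenvhat) : uact x (ustar u v) = uact (uact x u) v.
Proof. by rewrite -[u]uclass_repr -[v]uclass_repr ustarE !uactE tact_mul. Qed.

(* The value at a, in the completed enveloping algebra, of the power series   *)
(* with coefficients c. The k-th power of tincl a is supported on the words   *)
(* of length k, so that the sum below is the sum of the whole series.         *)
Definition useries (c : nat -> K) a : uenvhat :=
  uclass (fun w => \sum_(k < (size w).+1) c k * tpow (tincl a) k w).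

Definition uexp a : uenvhat := useries (fun k => k`!%:R^-1) a.

Lemma tpow_size a k w : (size w < k)%N -> tpow (tincl a) k w = 0.
Proof.
elim: k w => // k IH w hw; rewrite /tpow iterS -/(tpow _ _) /tmul big1 // => i _.
have [hi|hi] := ltnP i (size w).
  by rewrite IH ?mul0r // size_take hi; apply: leq_trans hi _.
by rewrite drop_oversize // mulr0.
Qed.

Lemma uact_series x (c : nat -> K) a T : uact x (useries c a) T =
  \sum_(k < rsize T) c k * iter k (fun y => prelie y a) x T.
Proof.
rewrite uactE; under [RHS]eq_bigr do rewrite -tact_pow.
rewrite -tact_sum; apply: tact_local => w hw.
have hs : ((size w).+1 <= rsize T)%N by rewrite (leq_ltn_trans (size_weight w)).
rewrite (big_ord_widen _ (fun k => c k * tpow (tincl a) k w) hs) big_mkcond.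
apply: eq_bigr => k _; case: ltnP => // hk.
by rewrite tpow_size ?mulr0.
Qed.

End Tensor.

(* The coefficients of the power series x / (exp x - 1), defined by the       *)
(* recursion expressing that (exp x - 1) / x is its inverse (todd_coefE).     *)
Fixpoint todd_seq (n : nat) : seq rat :=
  if n is m.+1 then
    let s := todd_seq m in
    rcons s ((m == 0%N)%:R - \sum_(k < m) s`_k / (m - k).+1`!%:R)
  else [::].

Definition todd_coef (n : nat) : rat := (todd_seq n.+1)`_n.

Lemma size_todd_seq n : size (todd_seq n) = n.
Proof. by elim: n => //= n IH; rewrite size_rcons IH. Qed.

Lemma todd_seq_nth n k : (k < n)%N -> (todd_seq n)`_k = todd_coef k.
Proof.
elim: n => // n IH; rewrite ltnS leq_eqVlt => /orP[/eqP-> //|hk].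
by rewrite /= nth_rcons size_todd_seq hk IH.
Qed.

Lemma todd_coefE n :
  \sum_(k < n.+1) todd_coef k * (n - k).+1`!%:R^-1 = (n == 0%N)%:R.
Proof.
rewrite big_ord_recr /= subnn invr1 mulr1 {2}/todd_coef /=.
rewrite nth_rcons size_todd_seq ltnn eqxx addrC -addrA.
rewrite -[RHS]addr0; congr (_ + _); apply/eqP; rewrite addrC subr_eq0; apply/eqP.
by apply: eq_bigr => k _; rewrite todd_seq_nth.
Qed.

Definition plscale (K : fieldType) (c : K) (a : plhat K) : plhat K :=
  fun T => c * a T.

Definition homog (K : fieldType) (n : nat) (a : plhat K) : plhat K :=
  fun T => if rsize T == n then a T else 0.

(* The series written A[q] = \sum_n q ^ n A_n. *)
Definition qscale (K : fieldType) (q : K) (a : plhat K) : plhat K :=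
  fun T => q ^+ rsize T * a T.

Notation "x %:F" := (@FracField.tofrac _ x) : ring_scope.
Notation Qq := {fraction {poly rat}}.
Definition qvar : Qq := ('X)%:F.

Definition scalars_to_Qq (a : plhat rat) : plhat Qq := fun T => ((a T)%:P)%:F.

Definition is_Omega (Omega : plhat rat) : Prop :=
  uact (tree rat bullet) (useries todd_coef Omega) = Omega.

Definition is_Omegaq (Omega : plhat rat) (Omegaq : plhat Qq) : Prop :=
  uact (qscale qvar Omegaq) (uexp (scalars_to_Qq Omega) - uone Qq)
    + qscale qvar Omegaq - Omegaq
  = prelie (tree Qq bullet) Omegaq + plscale (qvar - 1) (tree Qq bullet).

(* D is a generator of the ideal of Q[q] of the polynomials that clear the    *)
(* denominators of all the coefficients of a.                                 *)
Definition clears_denominators (a : plhat Qq) (D : {poly rat}) : Prop :=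
  forall T, exists p : {poly rat}, D%:F * a T = p%:F.

Definition is_common_denominator (a : plhat Qq) (D : {poly rat}) : Prop :=
  [/\ D != 0, clears_denominators a D &
      forall D', clears_denominators a D' -> D %| D'].

Lemma common_denominator_eqp a D D' :
  is_common_denominator a D -> is_common_denominator a D' -> D %= D'.
Proof. by move=> [_ h1 h2] [_ h1' h2']; rewrite /eqp h2 ?h2'. Qed.

(* Main.v *)
From HB Require Import structures.
Require Import Defs.
From mathcomp Require Import all_boot all_order all_algebra all_field.
From mathcomp Require Import boolp functions fraction ring.

(* Multiply the coefficient of a tree T by |Aut T|. The product               *)
(* x \curvearrowleft y then becomes the sum, over the edges of T, of x on the *)
(* trunk times y on the branch, and B_+(exp x) becomes the product ell x of x *)
(* over the subtrees at the root. If E is the action of exp(Omega), then      *)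
(* E (ell x) = ell (E x + bullet): both sides come from the same linear       *)
(* differential equation, and Omega \curvearrowleft ((exp(Omega) - 1) / Omega)*)
(* = bullet is the defining equation of Omega.                                *)
(* Put G_0 = 0 and G_(n+1) = E (G_n[q]) + bullet. By induction                *)
(* G_(n+1) - G_n = q^n ell G_n, so that at each tree T the G_n are the values *)
(* at the q-integers [n] of a polynomial p_T of degree at most #T. Comparing  *)
(* the two recursions at first order at 0 shows that p_T'(0) solves the       *)
(* equation of Omega_q, whose solution is unique. Now p_T is a combination of *)
(* the q-binomials [x; j], 1 <= j <= #T, with coefficients in Q[q, 1/q]       *)
(* since the G_n have such coefficients, and [x; j]'(0) is a unit times       *)
(* 1 / [j]. As [j] divides the product of the Phi_d, 2 <= d <= n, only powers *)
(* of q remain in the denominator, and the equation of Omega_q excludes them. *)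

Set Implicit Arguments.
Unset Strict Implicit.
Unset Printing Implicit Defensive.

Import GRing.Theory.
Local Open Scope ring_scope.

(** * Edge cuts, and coefficients normalised by automorphisms *)

(** A few lemmas carry the argument outlined above. [ncoef_prelie] turns grafting into edge cuts,
    and [cutexp_ell] turns the recursion of [qorder] into the difference equation [qorder_diff]. In
    the basis of q-binomials, summing that equation creates no denominators but powers of q
    ([qorder_poly]). Since [qequation_qorder] exhibits Omega_q as a derivative at 0, its only other
    denominators are the q-integers of [deriv_qbin_int]. A pole at q = 0 is excluded by
    [qequation_rpred], as the equation divides only by q^n - 1, and [localized_powX_at0] combines
    both facts. *)

Fixpoint picks (T : Type) (s : seq T) : seq (T * seq T) :=
  if s is a :: s' then (a, s') :: [seq (p.1, a :: p.2) | p <- picks s'] else [::].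

Arguments picks : simpl never.

Lemma picks_cons (T : Type) (a : T) s :
  picks (a :: s) = (a, s) :: [seq (p.1, a :: p.2) | p <- picks s].
Proof. by []. Qed.

Definition cuts_in (g : ptree -> seq (ptree * ptree)) :
    seq ptree -> seq (seq ptree * ptree) :=
  fix f s :=
    if s is a :: s' then
      [seq (c.1 :: s', c.2) | c <- g a] ++ [seq (a :: c.1, c.2) | c <- f s']
    else [::].

(* The pairs (trunk, branch) obtained by removing one edge of t. *)
Fixpoint cuts (t : ptree) : seq (ptree * ptree) :=
  let: Node s := t in
  [seq (Node p.2, p.1) | p <- picks s] ++ [seq (Node c.1, c.2) | c <- cuts_in cuts s].

Definition lcuts := cuts_in cuts.

Lemma sum_picks_cons (V : nmodType) (T : Type) (F : T * seq T -> V) a s :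
  \sum_(p <- picks (a :: s)) F p = F (a, s) + \sum_(p <- picks s) F (p.1, a :: p.2).
Proof. by rewrite big_cons big_map. Qed.

Lemma sum_cuts_Node (V : nmodType) (F : ptree * ptree -> V) s :
  \sum_(c <- cuts (Node s)) F c =
  \sum_(p <- picks s) F (Node p.2, p.1) + \sum_(c <- lcuts s) F (Node c.1, c.2).
Proof. by rewrite big_cat !big_map. Qed.

Lemma sum_lcuts_cons (V : nmodType) (F : seq ptree * ptree -> V) a s :
  \sum_(c <- lcuts (a :: s)) F c =
  \sum_(c <- cuts a) F (c.1 :: s, c.2) + \sum_(c <- lcuts s) F (a :: c.1, c.2).
Proof. by rewrite big_cat !big_map. Qed.

Lemma sumn_picks (T : eqType) (f : T -> nat) p s :
  p \in picks s -> sumn (map f s) = (f p.1 + sumn (map f p.2))%N.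
Proof.
elim: s p => // a s IH p; rewrite picks_cons inE => /orP[/eqP-> //|/mapP[p' /IH /= -> ->]] /=.
by rewrite addnCA.
Qed.

Lemma psize_cuts c t : c \in cuts t -> psize t = (psize c.1 + psize c.2)%N.
Proof.
elim/(@ptree_seq_ind (fun s => forall c, c \in lcuts s ->
  sumn (map psize s) = (sumn (map psize c.1) + psize c.2)%N)): t c => //.
- move=> s hs c; rewrite /= mem_cat => /orP[] /mapP[d hd ->] /=.
    by rewrite (sumn_picks psize hd) addnC.
  by rewrite (hs _ hd).
- move=> a s ha hs c; rewrite /= mem_cat => /orP[] /mapP[d hd ->] /=.
    by rewrite (ha _ hd) addnAC.
  by rewrite (hs _ hd) addnA.
Qed.

Lemma cuts_ltn c t : c \in cuts t -> (psize c.1 < psize t)%N /\ (psize c.2 < psize t)%N.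
Proof.
move=> /psize_cuts ->; split.
  by rewrite -addn1 leq_add2l psize_gt0.
by rewrite -add1n leq_add2r psize_gt0.
Qed.

Lemma picks_swap (V : nmodType) (T : Type) (F : T -> T -> seq T -> V) s :
  \sum_(p <- picks s) \sum_(p' <- picks p.2) F p.1 p'.1 p'.2 =
  \sum_(p <- picks s) \sum_(p' <- picks p.2) F p'.1 p.1 p'.2.
Proof.
elim: s F => [|a s IH] F; first by rewrite !big_nil.
rewrite !sum_picks_cons /=.
under [X in _ + X = _]eq_bigr do rewrite sum_picks_cons /=.
under [X in _ = _ + X]eq_bigr do rewrite sum_picks_cons /=.
rewrite !big_split /= addrCA; congr (_ + (_ + _)).
exact: (IH (fun x y r => F x y (a :: r))).
Qed.

(** A tree picked after an edge was cut is either the tree that was cut or another one: these are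
    the two terms on the right. *)
Lemma picks_lcuts (V : nmodType) (F : ptree -> seq ptree -> ptree -> V) s :
  \sum_(c <- lcuts s) \sum_(p <- picks c.1) F p.1 p.2 c.2 =
  \sum_(p <- picks s) (\sum_(c <- cuts p.1) F c.1 p.2 c.2 +
                       \sum_(c <- lcuts p.2) F p.1 c.1 c.2).
Proof.
elim: s F => [|a s IH] F; first by rewrite !big_nil.
rewrite sum_lcuts_cons sum_picks_cons /=.
under [X in X + _ = _]eq_bigr do rewrite sum_picks_cons /=.
under [X in _ + X = _]eq_bigr do rewrite sum_picks_cons /=.
under [X in _ = _ + X]eq_bigr do rewrite sum_lcuts_cons /=.
rewrite !big_split /= (IH (fun x r y => F x (a :: r) y)) !big_split /=.
rewrite [in X in X + _ = _]exchange_big /=.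
rewrite -!addrA; congr (_ + _); rewrite addrCA; congr (_ + _).
by rewrite [LHS]addrCA.
Qed.

(* The number of isomorphisms of rooted trees from t to t'. *)
Fixpoint niso (t t' : ptree) {struct t} : nat :=
  let: Node s := t in let: Node s' := t' in
  (fix aux (s s' : seq ptree) {struct s} : nat :=
    if s is a :: r then (\sum_(p <- picks s') niso a p.1 * aux r p.2)%N
    else s' == [::]) s s'.

Definition lniso (s s' : seq ptree) := niso (Node s) (Node s').

Lemma lniso_cons a r s' :
  lniso (a :: r) s' = (\sum_(p <- picks s') niso a p.1 * lniso r p.2)%N.
Proof. by []. Qed.

Lemma niso_gt0_iso t t' : (0 < niso t t')%N -> tree_iso t t'.
Proof.
have picks_split (T : eqType) p (s : seq T) : p \in picks s ->
    exists s1 s2, s = s1 ++ p.1 :: s2 /\ p.2 = s1 ++ s2.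
  elim: s p => // a s IH p; rewrite picks_cons inE => /orP[/eqP->|/mapP[p' /IH h ->]].
    by exists [::], s.
  by have [s1 [s2 [-> ->]]] := h; exists (a :: s1), s2.
elim/(@ptree_seq_ind (fun s => forall s', (0 < lniso s s')%N ->
  tree_iso (Node s) (Node s'))): t t'.
- by move=> s hs [s'] /hs.
- by case=> // _; exact: iso_leaf.
- move=> a s ha hs s'; rewrite lniso_cons lt0n sum_nat_seq_neq0.
  case/hasP=> p /picks_split[s1 [s2 [-> hp]]] /=; rewrite -lt0n muln_gt0.
  by case/andP=> h1 h2; apply: iso_node; [exact: ha | rewrite -hp; exact: hs].
Qed.

Lemma picks_mid (T : eqType) (a : T) s1 s2 : (a, s1 ++ s2) \in picks (s1 ++ a :: s2).
Proof.
elim: s1 => [|b s1 IH]; first exact: mem_head.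
by rewrite cat_cons picks_cons inE; apply/orP; right; apply/mapP; exists (a, s1 ++ s2).
Qed.

Lemma iso_niso_gt0 t t' : tree_iso t t' -> (0 < niso t t')%N.
Proof.
elim=> // {}t {}t' s s1 s2 _ ht _ hs.
rewrite -/(lniso (t :: s) _) lniso_cons lt0n sum_nat_seq_neq0.
by apply/hasP; exists (t', s1 ++ s2); rewrite ?picks_mid //= -lt0n muln_gt0 ht.
Qed.

(** The images of two children can be chosen in either order ([picks_swap]). This is what absorbs
    the sorting done by [tnorm]. *)
Lemma lniso_mid a s1 s2 s' : lniso (s1 ++ a :: s2) s' = lniso (a :: s1 ++ s2) s'.
Proof.
elim: s1 s' => // b s1 IH s'; rewrite !cat_cons lniso_cons.
under eq_bigr do rewrite IH lniso_cons big_distrr /=.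
rewrite (picks_swap (fun x y r => niso b x * (niso a y * lniso (s1 ++ s2) r))%N).
rewrite lniso_cons; apply: eq_bigr => p _; rewrite lniso_cons big_distrr /=.
by apply: eq_bigr => p' _; rewrite mulnCA.
Qed.

Lemma lniso_perm s r s' : perm_eq s r -> lniso s s' = lniso r s'.
Proof.
elim: s r s' => [|a s IH] r s'; first by rewrite perm_sym => /perm_nilP ->.
move=> h; have har : a \in r by rewrite -(perm_mem h) mem_head.
case/splitPr: har h => r1 r2 h; rewrite lniso_mid !lniso_cons.
by apply: eq_bigr => p _; rewrite (IH (r1 ++ r2)) // -(perm_mid a).
Qed.

Lemma niso_tnorm t t' : niso (tnorm t) t' = niso t t'.
Proof.
elim/(@ptree_seq_ind (fun s => forall s', lniso (map tnorm s) s' = lniso s s')): t t'.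
- move=> s hs [s']; rewrite -/(lniso s s') -hs.
  by apply: lniso_perm; rewrite perm_sort.
- by [].
- by move=> a s ha hs s' /=; rewrite !lniso_cons; apply: eq_bigr => p _; rewrite ha hs.
Qed.

(** Double count: an isomorphism from a graft of [B] on [A] onto [T] sends the new edge to an edge
    of [T], and restricts to isomorphisms from [A] to the trunk and from [B] to the branch; all such
    data arise once. *)
Lemma niso_grafts A B T :
  (\sum_(r <- grafts B A) niso r T = \sum_(c <- cuts T) niso A c.1 * niso B c.2)%N.
Proof.
elim/(@ptree_seq_ind (fun s => forall s', (\sum_(r <- lgrafts B s) lniso r s' =
  \sum_(c <- lcuts s') lniso s c.1 * niso B c.2)%N)): A T.
- move=> s hs [s']; rewrite sum_grafts sum_cuts_Node; congr (_ + _)%N.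
    by rewrite -/(lniso _ _) lniso_cons; apply: eq_bigr => p _; rewrite mulnC.
  exact: hs.
- move=> s'; rewrite big_nil big1_seq // => c hc.
  case: s' hc => // a s' /= hc; rewrite /lniso /=.
  suff -> : c.1 == [::] = false by [].
  by move: hc; rewrite mem_cat => /orP[] /mapP[d _ ->].
- move=> a s ha hs s'; rewrite sum_lgrafts.
  under [RHS]eq_bigr do rewrite lniso_cons big_distrl /=.
  rewrite (picks_lcuts (fun x r v => niso a x * lniso s r * niso B v)%N) big_split /=.
  congr (_ + _)%N.
    rewrite exchange_big; apply: eq_bigr => p _ /=.
    transitivity ((\sum_(r <- grafts B a) niso r p.1) * lniso s p.2)%N.
      by rewrite big_distrl.
    by rewrite ha big_distrl; apply: eq_bigr => c _; rewrite /= mulnAC.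
  rewrite exchange_big; apply: eq_bigr => p _ /=.
  transitivity (niso a p.1 * \sum_(r <- lgrafts B s) lniso r p.2)%N.
    by rewrite big_distrr.
  by rewrite hs big_distrr; apply: eq_bigr => c _; rewrite /= mulnA.
Qed.

Section Normalized.
Variable K : fieldType.
Implicit Types x y : plhat K.

(* Coefficients in the basis of the trees T / |Aut T|: [niso (tnorm t) t] is  *)
(* the order of the automorphism group of t.                                  *)
Definition ncoef x (t : ptree) : K := (niso (tnorm t) t)%:R * x (tclass t).

Lemma ncoefE m x t : (psize t <= m)%N ->
  ncoef x t = \sum_(T <- trees_le m) x T * (niso (ptree_of T) t)%:R.
Proof.
move=> ht; rewrite (bigD1_seq (tclass t)) ?uniq_trees_le ?mem_trees_le ?rsize_tclass //=.
rewrite big1 ?addr0 1?mulrC // => T hT.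
have [-> |] := posnP (niso (ptree_of T) t); first by rewrite mulr0.
by move=> /niso_gt0_iso/tclassP; rewrite ptree_ofK => hTt; rewrite hTt eqxx in hT.
Qed.

Lemma ncoef_prelie x y t :
  ncoef (prelie x y) t = \sum_(c <- cuts t) ncoef x c.1 * ncoef y c.2.
Proof.
set m := psize t; rewrite (ncoefE _ (leqnn m)).
under eq_big_seq => T.
  rewrite mem_trees_le => hT; rewrite (prelieE _ _ hT) mulr_suml.
  under eq_bigr do rewrite mulr_suml.
  over.
rewrite exchange_big /=.
transitivity (\sum_(A <- trees_le m) \sum_(B <- trees_le m) \sum_(c <- cuts t)
    (x A * (niso A c.1)%:R) * (y B * (niso B c.2)%:R)).
  apply: eq_bigr => A _; rewrite exchange_big; apply: eq_bigr => B _ /=.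
  under eq_bigr do rewrite -mulrA.
  rewrite -mulr_sumr (@sum_ngraft _ m (fun S => (niso S t)%:R)) => [|S hS]; last first.
    have [h|/niso_gt0_iso/tclassP] := posnP (niso S t); first by rewrite h eqxx in hS.
    by rewrite ptree_ofK => ->; rewrite rsize_tclass.
  under [X in _ * X = _]eq_bigr => r _ do rewrite -[ptree_of _]/(tnorm r) niso_tnorm.
  rewrite -natr_sum niso_grafts natr_sum mulr_sumr; apply: eq_bigr => c _.
  by rewrite natrM; ring.
under [LHS]eq_bigr do rewrite exchange_big /=.
rewrite exchange_big; apply: eq_big_seq => c /cuts_ltn[/ltnW h1 /ltnW h2] /=.
rewrite (ncoefE _ h1) (ncoefE _ h2) mulr_suml; apply: eq_bigr => A _.
by rewrite mulr_sumr.
Qed.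

Lemma ncoef_bullet t : ncoef (tree K bullet) t = (t == leaf)%:R.
Proof.
rewrite /ncoef /tree; have [->|ht] := eqVneq t leaf.
  by rewrite eqxx mulr1 /lniso.
case: eqP => [h|]; last by rewrite mulr0.
have := congr1 rsize h; rewrite !rsize_tclass; case: t ht {h} => [[|a s]] //= _ [].
by have := psize_gt0 a; case: (psize a).
Qed.

End Normalized.

(** * The action of the exponential *)

(** By [ncoef_prelie], this is the right action of [o] on [f] in normalised coefficients. The ring
    is general so that polynomial coefficients are allowed. *)
Definition cutact (R : comNzRingType) (o f : ptree -> R) : ptree -> R :=
  fun t => \sum_(c <- cuts t) f c.1 * o c.2.

(* The normalised coefficients of B_+(exp x), if those of x are given by x:   *)
(* normalising turns the symmetric exponential into a product.                *)
Definition ell (R : comNzRingType) (x : ptree -> R) (t : ptree) : R :=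
  let: Node s := t in \prod_(u <- s) x u.

Section CutAction.
Variable R : comNzRingType.
Implicit Types (o f g x : ptree -> R).

Lemma cutact_local o f g t :
  (forall u, (psize u < psize t)%N -> f u = g u) -> cutact o f t = cutact o g t.
Proof. by move=> h; apply: eq_big_seq => c /cuts_ltn[hc _]; rewrite h. Qed.

Lemma iter_cutact_local o f g k t :
  (forall u, (psize u <= psize t)%N -> f u = g u) ->
  iter k (cutact o) f t = iter k (cutact o) g t.
Proof.
elim: k t => [|k IH] t h; first exact: h.
rewrite !iterS; apply: cutact_local => u hu; apply: IH => v hv.
by apply: h; apply: leq_trans hv (ltnW hu).
Qed.

(** Each cut shrinks the trunk, so the action is locally nilpotent and sums truncated at [psize t]
    are whole series. *)
Lemma iter_cutact_eq0 o f k t : (psize t <= k)%N -> iter k (cutact o) f t = 0.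
Proof.
elim: k t => [|k IH] t; first by rewrite leqNgt psize_gt0.
move=> ht; rewrite iterS /cutact big1_seq // => c /cuts_ltn[hc _].
by rewrite IH ?mul0r // -ltnS (leq_trans hc).
Qed.

Lemma cutact_sum o (I : Type) (r : seq I) (c : I -> R) (f : I -> ptree -> R) t :
  cutact o (fun u => \sum_(i <- r) c i * f i u) t = \sum_(i <- r) c i * cutact o (f i) t.
Proof.
rewrite /cutact; under eq_bigr do rewrite mulr_suml.
rewrite exchange_big; apply: eq_bigr => i _ /=; rewrite mulr_sumr.
by apply: eq_bigr => p _; rewrite mulrA.
Qed.

Lemma cutactZ o a f t : cutact o (fun u => a * f u) t = a * cutact o f t.
Proof. by rewrite /cutact mulr_sumr; apply: eq_bigr => c _; rewrite mulrA. Qed.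

Lemma cutactD o f g t : cutact o (fun u => f u + g u) t = cutact o f t + cutact o g t.
Proof. by rewrite /cutact -big_split; apply: eq_bigr => c _; rewrite mulrDl. Qed.

Lemma iter_cutactZ o a f k t :
  iter k (cutact o) (fun u => a * f u) t = a * iter k (cutact o) f t.
Proof.
by elim: k t => // k IH t; rewrite !iterS -cutactZ; apply: cutact_local => u _.
Qed.

Lemma iter_cutactD o f g k t :
  iter k (cutact o) (fun u => f u + g u) t = iter k (cutact o) f t + iter k (cutact o) g t.
Proof.
by elim: k t => // k IH t; rewrite !iterS -cutactD; apply: cutact_local => u _.
Qed.

Lemma sum_lcuts_prod o x s :
  \sum_(c <- lcuts s) (\prod_(u <- c.1) x u) * o c.2 =
  \sum_(p <- picks s) cutact o x p.1 * \prod_(u <- p.2) x u.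
Proof.
elim: s => [|a s IH]; first by rewrite !big_nil.
rewrite sum_lcuts_cons sum_picks_cons /=; congr (_ + _).
  by rewrite mulr_suml; apply: eq_bigr => c _; rewrite big_cons mulrAC.
under eq_bigr do rewrite big_cons -mulrA.
under [RHS]eq_bigr do rewrite big_cons mulrCA.
by rewrite -!mulr_sumr IH.
Qed.

(** Leibniz rule: an edge at the root contributes [o] of its branch, any other edge acts inside the
    factor of one child. *)
Lemma cutact_ell o x s : cutact o (ell x) (Node s) =
  \sum_(p <- picks s) (cutact o x p.1 + o p.1) * \prod_(u <- p.2) x u.
Proof.
rewrite /cutact sum_cuts_Node /= sum_lcuts_prod addrC -big_split.
by apply: eq_bigr => p _ /=; rewrite mulrDl [o _ * _]mulrC.
Qed.

Lemma deriv_prod (I : Type) (s : seq I) (phi : I -> {poly R}) :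
  (\prod_(u <- s) phi u)^`() = \sum_(p <- picks s) (phi p.1)^`() * \prod_(u <- p.2) phi u.
Proof.
elim: s => [|a s IH]; first by rewrite !big_nil derivC.
rewrite big_cons derivM sum_picks_cons IH mulr_sumr; congr (_ + _).
by apply: eq_bigr => p _; rewrite big_cons mulrCA.
Qed.

End CutAction.

(** Applied below to coefficient extraction, evaluation, derivative at 0 and extension of
    scalars. *)
Lemma cutact_map (R R' : comNzRingType) (g : {additive R -> R'})
    (o f : ptree -> R) (o' : ptree -> R') t :
  (forall c u, g (c * o u) = g c * o' u) ->
  g (cutact o f t) = cutact o' (fun u => g (f u)) t.
Proof. by move=> h; rewrite /cutact raddf_sum; apply: eq_bigr => c _; rewrite h. Qed.

Lemma iter_cutact_map (R R' : comNzRingType) (g : {additive R -> R'})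
    (o f : ptree -> R) (o' : ptree -> R') k t :
  (forall c u, g (c * o u) = g c * o' u) ->
  g (iter k (cutact o) f t) = iter k (cutact o') (fun u => g (f u)) t.
Proof.
move=> h; elim: k t => // k IH t; rewrite !iterS (cutact_map _ _ h).
by apply: cutact_local => u _; rewrite IH.
Qed.

Definition cutexp (K : fieldType) (o f : ptree -> K) : ptree -> K :=
  fun t => \sum_(k < psize t) k`!%:R^-1 * iter k (cutact o) f t.

Section CutExp.
Variable K : fieldType.
Hypothesis charK : forall n, n.+1%:R != 0 :> K.
Implicit Types (o f x : ptree -> K) (b : nat -> K).

Lemma factSV n : n.+1`!%:R^-1 * n.+1%:R = n`!%:R^-1 :> K.
Proof. by rewrite factS natrM invfM mulrC mulVKf ?charK. Qed.

Lemma sum_iter_widen o f (c : nat -> K) n t : (psize t <= n)%N ->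
  \sum_(k < psize t) c k * iter k (cutact o) f t =
  \sum_(k < n) c k * iter k (cutact o) f t.
Proof.
move=> ht; rewrite (big_ord_widen _ (fun k => c k * iter k (cutact o) f t) ht).
rewrite big_mkcond; apply: eq_bigr => k _; case: ltnP => // hk.
by rewrite iter_cutact_eq0 ?mulr0.
Qed.

(** With D the action of [o], the hypotheses say that b is the inverse series of (e^x - 1)/x and
    that b(D) dot = o; applying (e^D - 1)/D recovers dot. D itself depends on [o], but only its
    linearity matters. *)
Lemma inverse_series_sum b o dot :
  (forall n, \sum_(k < n.+1) b k * (n - k).+1`!%:R^-1 = (n == 0%N)%:R) ->
  (forall t, \sum_(k < psize t) b k * iter k (cutact o) dot t = o t) ->
  forall t, \sum_(k < psize t) k.+1`!%:R^-1 * iter k (cutact o) o t = dot t.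
Proof.
move=> hb ho t; set N := psize t; pose d n := iter n (cutact o) dot t.
have iter_o k u : (psize u <= N)%N ->
    iter k (cutact o) o u = \sum_(j < N) b j * iter (j + k) (cutact o) dot u.
  elim: k u => [|k IH] u hu.
    rewrite [LHS]/= -ho (sum_iter_widen _ _ _ hu).
    by apply: eq_bigr => j _; rewrite addn0.
  rewrite iterS (@cutact_local _ o _ (fun v =>
    \sum_(j < N) b j * iter (j + k) (cutact o) dot v)); last first.
    by move=> v hv; rewrite IH // (leq_trans (ltnW hv)).
  by rewrite cutact_sum; apply: eq_bigr => j _; rewrite addnS iterS.
under eq_bigr do rewrite (iter_o _ _ (leqnn N)) mulr_sumr.
rewrite exchange_big /=.
(* Regrouping by n = j + k; the terms with n >= N vanish by nilpotency. *)
transitivity (\sum_(j < N) \sum_(n < N | (j <= n)%N) b j * (n - j).+1`!%:R^-1 * d n).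
  apply: eq_bigr => j _; rewrite -(big_mkord xpredT
    (fun k => k.+1`!%:R^-1 * (b j * iter (j + k) (cutact o) dot t))).
  rewrite -(big_mkord (fun n => j <= n)%N (fun n => b j * (n - j).+1`!%:R^-1 * d n)).
  rewrite (big_cat_nat (leq0n (N - j)) (leq_subr _ _)) /=.
  rewrite [X in _ + X]big1_seq ?addr0; last first.
    move=> k; rewrite mem_index_iota leq_subLR => /and3P[_ hk _].
    by rewrite iter_cutact_eq0 ?mulr0 ?mulr0.
  rewrite [RHS](big_cat_nat (leq0n j) (ltnW (ltn_ord j))) /=.
  rewrite [X in _ = X + _]big1_seq ?add0r; last first.
    by move=> k; rewrite mem_index_iota => /and3P[hjk _]; rewrite ltnNge hjk.
  rewrite -[X in \sum_(X <= _ < N | _) _]add0n big_addn.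
  apply: eq_big => k; first by rewrite leq_addl.
  by move=> _; rewrite addnK mulrCA mulrA /d addnC.
rewrite (exchange_big_dep xpredT) //=.
transitivity (\sum_(n < N) (n == 0%N :> nat)%:R * d n).
  apply: eq_bigr => n _; rewrite -hb mulr_suml.
  rewrite -(big_mkord (fun j => j <= n)%N (fun j => b j * (n - j).+1`!%:R^-1 * d n)).
  rewrite -(big_mkord xpredT (fun j => b j * (n - j).+1`!%:R^-1 * d n)).
  rewrite (big_cat_nat (leq0n n.+1) (ltn_ord n)) /=.
  rewrite [X in _ + X]big1_seq ?addr0; last first.
    by move=> k; rewrite mem_index_iota => /and3P[hkn hnk _]; rewrite ltnNge hkn in hnk.
  rewrite big_nat_cond [RHS]big_nat_cond; apply: eq_bigl => k /=.
  by rewrite ltnS; case: leqP.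
rewrite /N; case: (psize t) (psize_gt0 t) => // m _.
by rewrite big_ord_recl big1 ?addr0 ?mul1r // => k _; rewrite mul0r.
Qed.

(* Let phi be the solution of phi' = D phi + o with phi(0) = x, where D is the *)
(* action of o. Since D is compatible with ell, ell phi solves psi' = D psi,   *)
(* so that it is exp(s D) (ell x); the identity is obtained at s = 1.          *)
Lemma cutexp_ell o x t :
  (forall u, \sum_(k < psize u) k.+1`!%:R^-1 * iter k (cutact o) o u = (u == leaf)%:R) ->
  cutexp o (ell x) t = ell (fun u => cutexp o x u + (u == leaf)%:R) t.
Proof.
move=> ho; pose D := cutact o.
(* The k-th derivative of phi at 0, read off from phi' = D phi + o. *)
pose y k u := if k is j.+1 then iter k D x u + iter j D o u else x u.
have y_eq0 k u : (psize u < k)%N -> y k u = 0.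
  by case: k => // k hk; rewrite /y !iter_cutact_eq0 ?addr0 // ltnW.
have yS k u : y k.+1 u = D (y k) u + (k == 0%N)%:R * o u.
  case: k => [|k]; first by rewrite /= mul1r.
  by rewrite mul0r addr0 /y !iterS /D -cutactD.
pose phi u := \poly_(k < (psize u).+1) (y k u / k`!%:R).
have phiE k u : (phi u)`_k = y k u / k`!%:R.
  by rewrite coef_poly ltnS; case: leqP => // hk; rewrite y_eq0 ?mul0r.
pose oP u := (o u)%:P.
have coef_cutact k (f : ptree -> {poly K}) u : (cutact oP f u)`_k = D (fun v => (f v)`_k) u.
  by rewrite -[LHS]/(coefp k _); apply: cutact_map => c v; rewrite /= coefMC.
have dphi u : (phi u)^`() = cutact oP phi u + oP u.
  apply/polyP => k; rewrite coef_deriv coefD coef_cutact -mulr_natr phiE -mulrA factSV.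
  rewrite yS mulrDl coefC; congr (_ + _).
    rewrite mulrC -cutactZ; apply: cutact_local => v _.
    by rewrite phiE mulrC.
  by case: k => [|k]; rewrite ?mul1r ?invr1 ?mulr1 ?mul0r.
pose psi := ell phi.
have dpsi u : (psi u)^`() = cutact oP psi u.
  case: u => s; rewrite cutact_ell /psi /= deriv_prod.
  by apply: eq_bigr => p _; rewrite dphi.
have psiE k u : (psi u)`_k = iter k D (ell x) u / k`!%:R.
  elim: k u => [|k IH] u.
    rewrite invr1 mulr1 -horner_coef0; case: u => s /=.
    rewrite horner_prod; apply: eq_bigr => u _.
    by rewrite horner_coef0 phiE invr1 mulr1.
  have := congr1 (fun p : {poly K} => p`_k) (dpsi u).
  rewrite /= coef_deriv coef_cutact => h.
  apply: (mulIf (charK k)); transitivity ((psi u)`_k.+1 *+ k.+1); first exact: mulr_natr.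
  rewrite h -mulrA factSV [RHS]mulrC -cutactZ.
  by apply: cutact_local => v _; rewrite IH mulrC.
have psi_size u : (size (psi u) <= psize u)%N.
  by apply/leq_sizeP => k hk; rewrite psiE iter_cutact_eq0 ?mul0r.
transitivity (psi t).[1].
  rewrite (horner_coef_wide _ (psi_size t)); apply: eq_bigr => k _.
  by rewrite psiE expr1n mulr1 mulrC.
case: t => s; rewrite /psi /= horner_prod; apply: eq_bigr => u _.
rewrite horner_poly big_ord_recl /= expr1n invr1 !mulr1.
rewrite /cutexp (sum_iter_widen _ _ (fun k => k`!%:R^-1) (leqnSn _)) big_ord_recl /=.
rewrite invr1 mul1r -addrA; congr (_ + _).
rewrite -ho -big_split; apply: eq_bigr => k _ /=.
by rewrite expr1n mulr1 mulrDl ![_ * _^-1]mulrC.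
Qed.

End CutExp.

(** * Newton interpolation at the q-integers *)

Section QNewton.
Variables (K : fieldType) (q : K).

Definition qnat (n : nat) : K := \sum_(i < n) q ^+ i.

Lemma qnat0 : qnat 0 = 0. Proof. exact: big_ord0. Qed.

Lemma qnatS n : qnat n.+1 = qnat n + q ^+ n.
Proof. exact: big_ord_recr. Qed.

(** The shift of n acts on q-integers as x -> 1 + q x, so difference equations in n become
    polynomial identities in x. *)
Lemma qnatSl n : qnat n.+1 = 1 + q * qnat n.
Proof.
rewrite /qnat big_ord_recl mulr_sumr; congr (_ + _).
by apply: eq_bigr => i _; rewrite exprS.
Qed.

Lemma qnat_pow n : 1 + (q - 1) * qnat n = q ^+ n.
Proof. by apply: (addIr (qnat n)); rewrite addrC -[RHS]addrC -qnatS qnatSl; ring. Qed.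

Hypotheses (q_neq0 : q != 0) (qnat_inj : injective qnat).

Lemma qnat_neq0 n : qnat n.+1 != 0.
Proof. by rewrite -qnat0 (inj_eq qnat_inj). Qed.

(* The polynomial whose value at the q-integer of k is the q-binomial          *)
(* coefficient of k and j.                                                     *)
Fixpoint qbin (j : nat) : {poly K} :=
  if j is i.+1 then (q ^+ i * qnat i.+1)^-1 *: (qbin i * ('X - (qnat i)%:P)) else 1.

Arguments qbin : simpl never.

Lemma qbinS j : qbin j.+1 =
  (q ^+ j * qnat j.+1)^-1 *: (qbin j * ('X - (qnat j)%:P)).
Proof. by []. Qed.

Lemma size_qbin j : size (qbin j) = j.+1.
Proof.
elim: j => [|j IH]; first exact: size_poly1.
rewrite qbinS size_scale ?invr_eq0 ?mulf_neq0 ?expf_neq0 ?qnat_neq0 //.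
by rewrite size_Mmonic ?monicXsubC -?size_poly_gt0 ?IH // size_XsubC addn2.
Qed.

Lemma qbinS_horner j x :
  (qbin j.+1).[x] = (qbin j).[x] * (x - qnat j) / (q ^+ j * qnat j.+1).
Proof. by rewrite qbinS hornerZ hornerM hornerXsubC mulrC. Qed.

Lemma qbinS_shift j x : (qbin j.+1).[1 + q * x] = (qbin j).[x] * (1 + q * x) / qnat j.+1.
Proof.
elim: j => [|j IH].
  by rewrite qbinS_horner qnat0 subr0 expr0 mul1r ![(qbin 0).[_]]hornerC.
have e : 1 + q * x - qnat j.+1 = q * (x - qnat j) by rewrite qnatSl; ring.
rewrite qbinS_horner IH e qbinS_horner.
have h1 := qnat_neq0 j; have h2 := qnat_neq0 j.+1; have h3 := expf_neq0 j q_neq0.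
rewrite exprS; field.
by rewrite h1 h2 h3 q_neq0.
Qed.

(** The q-Pascal rule; by [qnat_pow], the factor 1 + (q - 1) x is q^k at the q-integer of k. *)
Lemma qbin_diff j x :
  (qbin j.+1).[1 + q * x] - (qbin j.+1).[x] = (1 + (q - 1) * x) * (qbin j).[x] / q ^+ j.
Proof.
rewrite qbinS_shift qbinS_horner.
have h1 := qnat_neq0 j; have h3 := expf_neq0 j q_neq0.
have e : q ^+ j = 1 + (q - 1) * qnat j by rewrite qnat_pow.
move: h1 h3; rewrite qnatSl e => h1 h3; field.
by rewrite h1 h3.
Qed.

Lemma qbinS_qnat0 j : (qbin j.+1).[qnat 0] = 0.
Proof.
elim: j => [|j IH]; last by rewrite qbinS_horner IH !mul0r.
by rewrite qbinS_horner subrr mulr0 mul0r.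
Qed.

Lemma qbin_qnatS j k : (qbin j.+1).[qnat k.+1] =
  (qbin j.+1).[qnat k] + q ^+ k * (qbin j).[qnat k] / q ^+ j.
Proof. by rewrite qnatSl -[LHS](subrK (qbin j.+1).[qnat k]) qbin_diff qnat_pow addrC. Qed.

Lemma qbin_small j k : (k < j)%N -> (qbin j).[qnat k] = 0.
Proof.
elim: k j => [|k IH] [|j] //; first by rewrite qbinS_qnat0.
by rewrite ltnS => hk; rewrite qbin_qnatS !IH ?(leqW hk) // mulr0 mul0r addr0.
Qed.

Lemma qbin_diag j : (qbin j).[qnat j] = 1.
Proof.
elim: j => [|j IH]; first exact: hornerC.
by rewrite qbin_qnatS qbin_small // IH add0r mulr1 divff ?expf_neq0.
Qed.

Lemma poly_qnat_eq0 n (p : {poly K}) :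
  (size p <= n)%N -> (forall k, (k < n)%N -> p.[qnat k] = 0) -> p = 0.
Proof.
move=> hp hk; apply: (@roots_geq_poly_eq0 _ _ [seq qnat k | k <- iota 0 n]).
- by apply/allP => y /mapP[k]; rewrite mem_iota => h ->; apply/rootP/hk.
- by rewrite map_inj_uniq ?iota_uniq.
- by rewrite size_map size_iota.
Qed.

Variable A : subringClosed K.
Hypotheses (Aq : q \in A) (AqV : q^-1 \in A).

Lemma qbin_int j k : (qbin j).[qnat k] \in A.
Proof.
elim: k j => [|k IH] [|j]; rewrite ?hornerC ?rpred1 //; first by rewrite qbinS_qnat0 rpred0.
by rewrite qbin_qnatS rpredD // -exprVn !rpredM ?rpredX.
Qed.

(** The values of [qbin j] at the q-integers are triangular with diagonal 1, and lie in [A], so the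
    coefficients are found successively without division. *)
Lemma q_newton n (r : {poly K}) : (size r <= n)%N -> (forall k, r.[qnat k] \in A) ->
  exists2 c : nat -> K, forall j, c j \in A & r = \sum_(j < n) c j *: qbin j.
Proof.
move=> hr hA.
have [c cA hc] : exists2 c : nat -> K, forall j, c j \in A &
    forall k, (k < n)%N -> (r - \sum_(j < n) c j *: qbin j).[qnat k] = 0.
  elim: n {hr} => [|n [c cA hc]]; first by exists (fun=> 0) => // j; exact: rpred0.
  (* The error left at the n-th node is the coefficient of [qbin n], which vanishes at the earlier
     nodes. *)
  pose e := (r - \sum_(j < n) c j *: qbin j).[qnat n].
  have eA : e \in A.
    rewrite /e hornerD hornerN horner_sum rpredB ?rpred_sum // => j _.
    by rewrite hornerZ rpredM ?qbin_int.
  exists (fun j => if j == n then e else c j); first by move=> j; case: eqP.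
  move=> k hk; rewrite big_ord_recr /= eqxx opprD addrA hornerD hornerN hornerZ.
  rewrite (eq_bigr (fun j : 'I_n => c j *: qbin j)); last first.
    by move=> j _; rewrite ltn_eqF.
  move: hk; rewrite ltnS leq_eqVlt => /orP[/eqP->|hk].
    by rewrite qbin_diag mulr1 subrr.
  by rewrite hc // qbin_small // mulr0 subr0.
exists c => //; apply/eqP; rewrite -subr_eq0; apply/eqP/(poly_qnat_eq0 _ hc).
apply: leq_trans (size_polyD _ _) _; rewrite size_polyN geq_max hr /=.
apply: leq_trans (size_sum _ _ _) _; apply/bigmax_leqP => j _.
by rewrite (leq_trans (size_scale_leq _ _)) // size_qbin.
Qed.

(** At 0 only the factor x gets differentiated; the other q-integers cancel, leaving a sign and a
    power of 1/q. *)
Lemma deriv_qbin_int j : qnat j.+1 * (qbin j.+1)^`().[0] \in A.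
Proof.
elim: j => [|j IH].
  rewrite qbinS [qbin 0 * _]mul1r derivZ derivB derivX derivC subr0 hornerZ hornerC mulr1.
  by rewrite expr0 mul1r divff ?rpred1 // qnat_neq0.
have -> : qnat j.+2 * (qbin j.+2)^`().[0] =
    - (qnat j.+1 * (qbin j.+1)^`().[0] * q^-1 ^+ j.+1).
  have e0 : (qbin j.+1).[0] = 0 by rewrite -[X in _.[X]]qnat0 qbinS_qnat0.
  rewrite qbinS derivZ derivM derivB derivX derivC subr0.
  rewrite hornerZ hornerD !hornerM e0 mul0r addr0 hornerXsubC sub0r.
  have h2 := qnat_neq0 j.+1; have h3 := expf_neq0 j.+1 q_neq0.
  by rewrite exprVn; field; rewrite h2 h3.
by rewrite rpredN rpredM ?rpredX.
Qed.

End QNewton.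

Arguments qbin : simpl never.

(** * Denominators *)

Section Localization.
Variable F : fieldType.

Definition localized (S : {pred {poly F}}) : {pred {fraction {poly F}}} :=
  fun f => `[< exists2 s, s \in S & exists p, s%:F * f = p%:F >].

Lemma localizedP (S : {pred {poly F}}) f :
  reflect (exists2 s, s \in S & exists p, s%:F * f = p%:F) (f \in localized S).
Proof. exact: asboolP. Qed.

Lemma localized_subring (S : mulrClosed {poly F}) : subring_closed (localized S).
Proof.
split.
- by apply/localizedP; exists 1; [exact: rpred1 | exists 1; rewrite mulr1].
- move=> f g /localizedP[s hs [p hp]] /localizedP[r hr [m hm]]; apply/localizedP.
  exists (s * r); first exact: rpredM.
  exists (p * r - s * m); rewrite tofracB !tofracM -hp -hm; ring.
- move=> f g /localizedP[s hs [p hp]] /localizedP[r hr [m hm]]; apply/localizedP.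
  exists (s * r); first exact: rpredM.
  exists (p * m); rewrite !tofracM -hp -hm; ring.
Qed.

HB.instance Definition _ (S : mulrClosed {poly F}) :=
  GRing.isSubringClosed.Build {fraction {poly F}} (localized S) (localized_subring S).

Lemma localized_poly (S : mulrClosed {poly F}) p : p%:F \in localized S.
Proof. by apply/localizedP; exists 1; [exact: rpred1 | exists p; rewrite mul1r]. Qed.

Lemma localized_inv (S : {pred {poly F}}) s : s \in S -> (s%:F)^-1 \in localized S.
Proof.
move=> hs; apply/localizedP; have [->|s0] := eqVneq (s%:F) 0.
  by exists s => //; exists 0; rewrite invr0 mulr0.
by exists s => //; exists 1; rewrite divff.
Qed.

Definition powX : {pred {poly F}} := fun p => `[< exists n, p = 'X^n >].

Lemma powX_mul : mulr_closed powX.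
Proof.
split; first by apply/asboolP; exists 0%N.
move=> p r /asboolP[n ->] /asboolP[m ->]; apply/asboolP.
by exists (n + m)%N; rewrite exprD.
Qed.

HB.instance Definition _ := GRing.isMulClosed.Build {poly F} powX powX_mul.

Definition nonzero_at0 : {pred {poly F}} := fun p => p.[0] != 0.

Lemma nonzero_at0_mul : mulr_closed nonzero_at0.
Proof.
split; first by rewrite unfold_in hornerC oner_neq0.
by move=> p r hp hr; rewrite unfold_in hornerM mulf_neq0.
Qed.

HB.instance Definition _ := GRing.isMulClosed.Build {poly F} nonzero_at0 nonzero_at0_mul.

(** A power of X is coprime to a polynomial not vanishing at 0; a Bezout relation between the two
    denominators removes both. *)
Lemma localized_powX_at0 f :
  f \in localized powX -> f \in localized nonzero_at0 -> exists p, f = p%:F.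
Proof.
move=> /localizedP[_ /asboolP[n ->] [p hp]] /localizedP[s hs [r hr]].
have : coprimep ('X^n) s.
  rewrite coprimep_expl // coprimep_sym -['X]subr0 -polyC0 coprimep_XsubC.
  exact: hs.
move=> /Bezout_eq1_coprimepP[[u v] /= huv].
exists (u * p + v * r); rewrite -[LHS]mul1r -tofrac1 -huv.
by rewrite !tofracD !tofracM -hp -hr /=; ring.
Qed.

End Localization.

(** * Polynomiality, and the equation of Omega_q *)

Lemma rpred_iter_cutact (R : comNzRingType) (A : subringClosed R) (o f : ptree -> R) k t :
  (forall u, o u \in A) -> (forall u, (psize u <= psize t)%N -> f u \in A) ->
  iter k (cutact o) f t \in A.
Proof.
move=> ho; elim: k t => [|k IH] t hf; first exact: hf.
rewrite iterS /cutact big_seq rpred_sum // => c /cuts_ltn[hc _].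
apply: rpredM; last exact: ho.
by apply: IH => u hu; apply: hf; apply: leq_trans hu (ltnW hc).
Qed.

Lemma prod_zero (R : comNzRingType) (I : eqType) (s : seq I) :
  \prod_(u <- s) (0 : R) = (s == [::])%:R.
Proof. by case: s => [|a s]; rewrite ?big_nil ?big_cons ?mul0r. Qed.

Lemma Node_eq_leaf s : (Node s == leaf) = (s == [::]).
Proof. by apply/eqP/eqP => [[->]|->]. Qed.

Section QEquation.
Variables (K : fieldType) (q : K) (o : ptree -> K).
Implicit Types (f g x : ptree -> K).

Definition qtwist x (t : ptree) : K := q ^+ psize t * x t.

Lemma qtwist_ell x t : qtwist (ell x) t = q * ell (qtwist x) t.
Proof.
case: t => s; rewrite /qtwist /= exprS -mulrA; congr (_ * _).
elim: s => [|a s IH]; first by rewrite !big_nil mulr1.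
by rewrite !big_cons -IH /= exprD; ring.
Qed.

Lemma cutexpB f g t : cutexp o (fun u => f u - g u) t = cutexp o f t - cutexp o g t.
Proof.
rewrite /cutexp -sumrB; apply: eq_bigr => k _; rewrite -mulrBr.
rewrite -[- iter _ _ g t]mulN1r -[_ * iter _ _ g t]iter_cutactZ -iter_cutactD.
by congr (_ * _); apply: iter_cutact_local => u _; rewrite mulN1r.
Qed.

Lemma cutexpZ a f t : cutexp o (fun u => a * f u) t = a * cutexp o f t.
Proof.
rewrite /cutexp mulr_sumr; apply: eq_bigr => k _.
by rewrite iter_cutactZ mulrCA.
Qed.

Lemma cutexp_ext f g t : f =1 g -> cutexp o f t = cutexp o g t.
Proof. by move=> /funext ->. Qed.

Definition cutexp_tail f t :=
  \sum_(k < (psize t).-1) k.+1`!%:R^-1 * iter k.+1 (cutact o) f t.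

Lemma cutexp_tailE f t : cutexp o f t = f t + cutexp_tail f t.
Proof.
rewrite /cutexp /cutexp_tail; case: (psize t) (psize_gt0 t) => // n _.
by rewrite big_ord_recl invr1 mul1r.
Qed.

Lemma cutexp_tail_local f g t :
  (forall u, (psize u < psize t)%N -> f u = g u) -> cutexp_tail f t = cutexp_tail g t.
Proof.
move=> h; apply: eq_bigr => k _; rewrite !iterSr; congr (_ * _).
apply: iter_cutact_local => u hu; apply: cutact_local => v hv.
by apply: h; apply: leq_trans hv hu.
Qed.

(* The equation defining Omega_q, in normalised coefficients. *)
Definition qequation x := forall t, cutexp o (qtwist x) t - x t =
  \sum_(c <- cuts t) (c.1 == leaf)%:R * x c.2 + (q - 1) * (t == leaf)%:R.

(** At [t] the unknown enters with coefficient q^#t - 1; all other terms involve smaller trees. *)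
Lemma qequation_unique x y : (forall n, q ^+ n.+1 != 1) ->
  qequation x -> qequation y -> x =1 y.
Proof.
move=> hq hx hy t; have [n] := ubnP (psize t); elim: n t => // n IH t ht.
have hlt u : (psize u < psize t)%N -> x u = y u.
  by move=> hu; apply: IH; apply: leq_trans hu ht.
have := hx t; rewrite (eq_big_seq (fun c => (c.1 == leaf)%:R * y c.2)); last first.
  by move=> c /cuts_ltn[_ hc]; rewrite hlt.
rewrite -(hy t) !cutexp_tailE (@cutexp_tail_local _ (qtwist y)); last first.
  by move=> u hu; rewrite /qtwist hlt.
rewrite -!addrA ![cutexp_tail _ _ + _]addrC !addrA => /addIr.
rewrite /qtwist -[X in _ - X = _]mul1r -[X in _ = _ - X]mul1r -!mulrBl.
apply: mulfI; rewrite subr_eq0; case: (psize t) (psize_gt0 t) => // m _.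
Qed.

Lemma qequation_rpred (A : subringClosed K) x t :
  q \in A -> (forall n, (q ^+ n.+1 - 1)^-1 \in A) -> (forall n, n`!%:R^-1 \in A) ->
  (forall n, q ^+ n.+1 != 1) -> (forall u, o u \in A) -> qequation x -> x t \in A.
Proof.
move=> qA hqA factA hq oA hx; have [n] := ubnP (psize t); elim: n t => // n IH t ht.
have hlt u : (psize u < psize t)%N -> x u \in A.
  by move=> hu; apply: IH; apply: leq_trans hu ht.
have [m hm] : exists m, psize t = m.+1 by exists (psize t).-1; rewrite prednK ?psize_gt0.
have h : (q ^+ m.+1 - 1) * x t = \sum_(c <- cuts t) (c.1 == leaf)%:R * x c.2
    + (q - 1) * (t == leaf)%:R - cutexp_tail (qtwist x) t.
  by rewrite -hx cutexp_tailE /qtwist hm; ring.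
rewrite -[x t](mulKf (x := q ^+ m.+1 - 1)) ?subr_eq0 // h.
rewrite rpredM // rpredB ?rpredD //.
- by rewrite big_seq rpred_sum // => c /cuts_ltn[_ hc]; rewrite rpredM ?hlt ?rpred_nat.
- by rewrite rpredM ?rpred_nat // rpredB ?rpred1.
- rewrite rpred_sum // => k _; rewrite rpredM // iterSr rpred_iter_cutact // => u hu.
  rewrite /cutact big_seq rpred_sum // => c /cuts_ltn[hc _].
  by rewrite !rpredM ?rpredX ?hlt // (leq_trans hc).
Qed.

Hypothesis charK : forall n, n.+1%:R != 0 :> K.
Hypotheses (q_neq0 : q != 0) (qnat_inj : injective (qnat q)).
Hypothesis ho : forall t,
  \sum_(k < psize t) k.+1`!%:R^-1 * iter k (cutact o) o t = (t == leaf)%:R.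

(* The coefficient of T in qorder n is, up to normalisation, the sum of        *)
(* q ^ (\sum_v a v) over the maps a from the vertices of T to {0, ..., n - 1}  *)
(* that decrease strictly away from the root.                                  *)
Fixpoint qorder (n : nat) : ptree -> K :=
  if n is m.+1 then fun t => cutexp o (qtwist (qorder m)) t + (t == leaf)%:R
  else fun=> 0.

(** The exponential sends the twisted difference q^(n+1) ell (G_n[q]) to q^(n+1) ell G_(n+1), by
    [cutexp_ell]. *)
Lemma qorder_diff n t : qorder n.+1 t - qorder n t = q ^+ n * ell (qorder n) t.
Proof.
elim: n t => [|n IH] t.
  rewrite /= subr0 mul1r (@cutexp_ext _ (fun u => 0 * 0)); last first.
    by move=> u; rewrite /qtwist !mulr0.
  by rewrite cutexpZ mul0r add0r; case: t => s; rewrite Node_eq_leaf /= prod_zero.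
rewrite [qorder n.+2 t]/= [X in _ - X]/= opprD addrACA subrr addr0 -cutexpB.
rewrite (@cutexp_ext _ (fun u => q ^+ n.+1 * ell (qtwist (qorder n)) u)).
  by rewrite cutexpZ (cutexp_ell charK _ _ ho).
move=> u; rewrite -mulrBr IH mulrCA -/(qtwist (ell _) u) qtwist_ell.
by rewrite mulrA -exprSr.
Qed.

Variable A : subringClosed K.
Hypotheses (Aq : q \in A) (AqV : q^-1 \in A).
Hypotheses (Afact : forall n, n`!%:R^-1 \in A) (Ao : forall t, o t \in A).

Lemma qorder_int n t : qorder n t \in A.
Proof.
elim: n t => [|n IH] t; first exact: rpred0.
rewrite rpredD ?rpred_nat // rpred_sum // => k _.
by rewrite rpredM // rpred_iter_cutact // => u _; rewrite rpredM ?rpredX.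
Qed.

Lemma qorder_poly t : exists p : {poly K},
  (exists2 c : nat -> K, forall j, c j \in A &
     p = \sum_(j < psize t) c j *: qbin q j.+1) /\
  (forall n, p.[qnat q n] = qorder n t).
Proof.
elim/(@ptree_seq_ind (fun s => exists2 r : {poly K},
  (size r <= (sumn (map psize s)).+1)%N &
  forall n, r.[qnat q n] = \prod_(u <- s) qorder n u)): t.
- move=> s [r hr hrn].
  have rA n : r.[qnat q n] \in A by rewrite hrn rpred_prod // => u _; exact: qorder_int.
  have [c cA hc] := q_newton q_neq0 qnat_inj Aq AqV hr rA.
  (* An antidifference: by q-Pascal, q^n times the q-binomial [n; j] is q^j times the increment of
     [n; j + 1]. *)
  exists (\sum_(j < psize (Node s)) (c j * q ^+ j) *: qbin q j.+1); split.
    by exists (fun j => c j * q ^+ j) => // j; rewrite rpredM ?rpredX.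
  elim=> [|n IH].
    by rewrite horner_sum big1 // => j _; rewrite hornerZ qbinS_qnat0 mulr0.
  rewrite -[RHS](subrK (qorder n (Node s))) qorder_diff -IH [ell _ _]/= -hrn hc !horner_sum.
  rewrite mulr_sumr -big_split; apply: eq_bigr => j _ /=.
  rewrite !(hornerZ _ (qbin q _)) qbin_qnatS // mulrDr addrC; congr (_ + _).
  by field; rewrite expf_neq0.
- by exists 1 => [|n]; rewrite ?size_poly1 // big_nil hornerC.
- move=> a s [p [[c _ hp] hpn]] [r hr hrn]; exists (p * r).
    have hps : (size p <= (psize a).+1)%N.
      rewrite hp (leq_trans (size_sum _ _ _)) //; apply/bigmax_leqP => j _.
      by rewrite (leq_trans (size_scale_leq _ _)) // size_qbin // ltnS.
    apply: leq_trans (size_polyMleq _ _) _; rewrite -subn1 leq_subLR add1n.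
    by apply: leq_trans (leq_add hps hr) _; rewrite addSn addnS.
  by move=> n; rewrite hornerM hpn hrn big_cons.
Qed.

(** The recursion and [qorder_diff] give two expressions of G_(n+1). They agree at all q-integers,
    hence as polynomials, and so do their derivatives at 0, where every [p u] vanishes. *)
Lemma qequation_qorder (p : ptree -> {poly K}) :
  (forall t n, (p t).[qnat q n] = qorder n t) -> qequation (fun t => (p t)^`().[0]).
Proof.
move=> hp t; have p0 u : (p u).[0] = 0 by rewrite -[X in _.[X]](qnat0 q) hp.
pose oP u := (o u)%:P.
pose E := \sum_(k < psize t) (k`!%:R^-1)%:P *
  iter k (cutact oP) (fun u => (q ^+ psize u)%:P * p u) t.
have hE : E = p t + (1 + (q - 1) *: 'X) * ell p t - (t == leaf)%:R%:P.
  apply/eqP; rewrite -subr_eq0; apply/eqP/(poly_qnat_eq0 qnat_inj (leqnn _)) => n _.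
  have -> : E - (p t + (1 + (q - 1) *: 'X) * ell p t - (t == leaf)%:R%:P) =
            E + (t == leaf)%:R%:P - p t - (1 + (q - 1) *: 'X) * ell p t by ring.
  rewrite !(hornerD, hornerN) hornerM hornerD hornerZ hornerX !hornerC hp.
  have -> : (ell p t).[qnat q n] = ell (qorder n) t.
    by case: (t) => s /=; rewrite horner_prod; apply: eq_bigr => u _; rewrite hp.
  rewrite qnat_pow -qorder_diff.
  have -> : E.[qnat q n] = cutexp o (qtwist (qorder n)) t.
    rewrite horner_sum; apply: eq_bigr => k _; rewrite hornerM hornerC; congr (_ * _).
    rewrite -[LHS]/(horner_eval (qnat q n) _) (@iter_cutact_map _ _ _ _ _ o); last first.
      by move=> c u; rewrite /= /horner_eval hornerM hornerC.
    apply: iter_cutact_local => u _.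
    by rewrite /= /horner_eval hornerM hornerC hp.
  by rewrite /=; ring.
have := congr1 (fun r : {poly K} => r^`().[0]) hE.
have -> : E^`().[0] = cutexp o (qtwist (fun u => (p u)^`().[0])) t.
  rewrite raddf_sum horner_sum; apply: eq_bigr => k _.
  rewrite /= derivM derivC mul0r add0r hornerM hornerC; congr (_ * _).
  rewrite -[LHS]/((horner_eval 0 \o @deriv K) _) (@iter_cutact_map _ _ _ _ _ o); last first.
    move=> c u; rewrite /= /horner_eval derivM derivC mulr0 addr0.
    by rewrite hornerM hornerC.
  apply: iter_cutact_local => u _.
  by rewrite /= /horner_eval derivM derivC mul0r add0r hornerM hornerC.
move=> ->; rewrite derivB derivD derivM derivD derivZ derivX !derivC.
rewrite !(hornerD, hornerN, hornerM, hornerZ) hornerX !hornerC.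
case: t {E hE} => s; rewrite sum_cuts_Node /= deriv_prod horner_prod.
rewrite horner_sum.
(* A cut inside a child leaves a trunk that is not a leaf. *)
rewrite [X in _ = _ + X + _]big1_seq; last first.
  move=> c /andP[_]; case: s => // a s /=.
  by rewrite mem_cat => /orP[] /mapP[d _ ->]; rewrite Node_eq_leaf mul0r.
rewrite (eq_bigr (fun=> 0)) => [|u _]; last exact: p0.
rewrite prod_zero Node_eq_leaf.
rewrite (eq_bigr (fun p1 : ptree * seq ptree => (Node p1.2 == leaf)%:R * (p p1.1)^`().[0])).
  by ring.
move=> c _; rewrite hornerM horner_prod (eq_bigr (fun=> 0)) => [|u _]; last exact: p0.
by rewrite prod_zero Node_eq_leaf mulrC.
Qed.

Lemma qequation_integral x n L t : (forall n, q ^+ n.+1 != 1) -> qequation x ->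
  (psize t <= n)%N -> (forall k, (k < n)%N -> exists2 c, c \in A & L = c * qnat q k.+1) ->
  L * x t \in A.
Proof.
move=> hq hx ht hL; have [p hp] := boolp.choice qorder_poly.
have -> := qequation_unique hq hx (qequation_qorder (fun u => (hp u).2)) t.
have [[c cA ->] _] := hp t.
rewrite raddf_sum horner_sum mulr_sumr rpred_sum // => j _ /=.
rewrite derivZ hornerZ; have [d dA ->] := hL j (leq_trans (ltn_ord j) ht).
rewrite (_ : _ * _ = d * c j * (qnat q j.+1 * (qbin q j.+1)^`().[0])); last by ring.
by apply: rpredM; [apply: rpredM | apply: deriv_qbin_int].
Qed.

End QEquation.

(** * The common denominator *)

Lemma ncoef_iter_prelie (K : fieldType) (x a : plhat K) k t :
  ncoef (iter k (fun y => prelie y a) x) t = iter k (cutact (ncoef a)) (ncoef x) t.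
Proof.
elim: k t => // k IH t; rewrite !iterS ncoef_prelie.
by apply: eq_bigr => p _; rewrite IH.
Qed.

Lemma ncoef_uact_series (K : fieldType) (x : plhat K) (c : nat -> K) a t :
  ncoef (uact x (useries c a)) t =
  \sum_(k < psize t) c k * iter k (cutact (ncoef a)) (ncoef x) t.
Proof.
rewrite {1}/ncoef uact_series rsize_tclass mulr_sumr; apply: eq_bigr => k _.
by rewrite mulrCA -ncoef_iter_prelie.
Qed.

(** A nonzero clearing polynomial of least size divides all others, since remainders also clear. *)
Lemma clear_common_denominator (a : plhat Qq) L : L != 0 -> clears_denominators a L ->
  exists2 D, is_common_denominator a D & D %| L.
Proof.
move=> L0 hL; pose P n := `[< exists D, [/\ D != 0, clears_denominators a D & size D = n] >].
have exP : exists n, P n by exists (size L); apply/asboolP; exists L.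
case: (ex_minnP exP) => n /asboolP[D [D0 hD sD]] minD.
have hdiv D' : clears_denominators a D' -> D %| D'.
  move=> hD'; apply/negPn/negP; rewrite /dvdp -size_poly_eq0 size_poly_eq0 => hmod.
  have /minD : P (size (D' %% D)).
    apply/asboolP; exists (D' %% D); split=> // T.
    have [p hp] := hD T; have [p' hp'] := hD' T.
    exists (p' - D' %/ D * p).
    rewrite tofracB tofracM -hp -hp' mulrA -tofracM -mulrBl -tofracB; congr (_%:F * _).
    by rewrite {2}(divp_eq D' D) addrC addKr.
  by rewrite -sD leqNgt ltn_modp D0.
by exists D; [split | exact: hdiv].
Qed.

Definition qpoly (n : nat) : {poly rat} := \sum_(i < n) 'X^i.

Lemma qnat_qvar n : qnat qvar n = (qpoly n)%:F.
Proof. by rewrite /qnat /qpoly rmorph_sum; apply: eq_bigr => i _; rewrite /= tofracXn. Qed.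

(** After multiplication by X - 1 = Phi_1, the left side is X^(k+1) - 1, the product of Phi_d over
    the divisors d of k + 1. *)
Lemma qpoly_dvd n k : (k < n)%N ->
  qpoly k.+1 %| \prod_(2 <= d < n.+1) map_poly intr 'Phi_d.
Proof.
move=> hk; pose f d : {poly rat} := map_poly intr 'Phi_d.
have prodf m : (0 < m)%N -> \prod_(d <- divisors m) f d = 'X^m - 1.
  move=> m0; have := congr1 (map_poly (intr : int -> rat)) (prod_Cyclotomic m0).
  by rewrite rmorph_prod rmorphB rmorph1 /= map_polyXn.
have hX1 : 'X - 1 != 0 :> {poly rat} by rewrite -polyC1 polyXsubC_eq0.
have hf1 : f 1%N = 'X - 1 by rewrite -(expr1 'X) -prodf // big_seq1.
rewrite -(dvdp_mul2l _ _ hX1) -{2}hf1 /qpoly -subrX1 -prodf //.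
have -> : f 1%N * \prod_(2 <= d < n.+1) f d = \prod_(1 <= d < n.+1) f d.
  by rewrite [RHS]big_ltn // ltnS (leq_ltn_trans _ hk).
rewrite [X in _ %| X](bigID (mem (divisors k.+1))) /=; apply: dvdp_mulr.
rewrite -[X in _ %| X]big_filter.
rewrite (perm_big [seq d <- index_iota 1 n.+1 | d \in divisors k.+1]) //=.
apply: uniq_perm; rewrite ?divisors_uniq ?filter_uniq ?iota_uniq // => d.
rewrite mem_filter mem_index_iota -dvdn_divisors //.
case: (boolP (d %| k.+1)%N) => //= hd; rewrite (dvdn_gt0 _ hd) //=.
by rewrite ltnS (leq_trans (dvdn_leq _ hd)).
Qed.

Definition rat_Qq : {rmorphism rat -> Qq} := @FracField.tofrac {poly rat} \o polyC.

Lemma ncoef_scalars a t : ncoef (scalars_to_Qq a) t = rat_Qq (ncoef a t).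
Proof. by rewrite /ncoef rmorphM rmorph_nat. Qed.

Lemma rat_Qq_localized (S : mulrClosed {poly rat}) c : rat_Qq c \in localized S.
Proof. exact: localized_poly. Qed.

Lemma natr_Qq_neq0 n : n.+1%:R != 0 :> Qq.
Proof.
by rewrite -(rmorph_nat rat_Qq) fmorph_eq0 Num.Theory.pnatr_eq0.
Qed.

Lemma expr_qvar_neq1 n : qvar ^+ n.+1 != 1.
Proof.
rewrite /qvar -tofracXn -tofrac1 tofrac_eq; apply/eqP=> /(congr1 (size \o polyseq)).
by rewrite /= size_polyXn size_poly1.
Qed.

Lemma qnat_qvar_inj : injective (qnat qvar).
Proof.
move=> n m; rewrite !qnat_qvar => /eqP; rewrite tofrac_eq => /eqP.
have hs k : size (qpoly k) = k.
  elim: k => [|k IH]; first by rewrite /qpoly big_ord0 size_poly0.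
  by rewrite /qpoly big_ord_recr /= addrC size_polyDl size_polyXn // ltnS -/(qpoly k) IH.
by move=> /(congr1 (size \o polyseq)); rewrite /= !hs.
Qed.

Theorem proposition6p2 (Omega : plhat rat) (Omegaq : plhat Qq)
  (hOmega : is_Omega Omega) (hOmegaq : is_Omegaq Omega Omegaq)
  (n : nat) (hn : (1 <= n)%N) :
  exists2 D : {poly rat}, is_common_denominator (homog n Omegaq) D &
    D %| \prod_(2 <= d < n.+1) map_poly intr 'Phi_d.
Proof.
pose o := ncoef (scalars_to_Qq Omega); pose x := ncoef Omegaq.
(* The equation of Omega is inverted over the rationals and then carried to Q(q). *)
have ho t : \sum_(k < psize t) k.+1`!%:R^-1 * iter k (cutact o) o t = (t == leaf)%:R.
  have charQ m : m.+1%:R != 0 :> rat by rewrite Num.Theory.pnatr_eq0.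
  have hQ u : \sum_(k < psize u) todd_coef k *
      iter k (cutact (ncoef Omega)) (ncoef (tree rat bullet)) u = ncoef Omega u.
    by rewrite -ncoef_uact_series hOmega.
  have := congr1 rat_Qq (inverse_series_sum todd_coefE hQ t).
  rewrite ncoef_bullet rmorph_nat => <-; rewrite rmorph_sum; apply: eq_bigr => k _.
  rewrite rmorphM fmorphV rmorph_nat; congr (_ * _).
  rewrite (@iter_cutact_map _ _ _ _ _ o) => [|c u]; last first.
    by rewrite -[LHS]/(rat_Qq _) rmorphM -ncoef_scalars.
  by apply: iter_cutact_local => u _; apply: ncoef_scalars.
have hx : qequation qvar o x.
  move=> t; have := congr1 (fun y : plhat Qq => y (tclass t)) hOmegaq.
  rewrite uactB uact1 subrK !(fsubE, faddE) => /(congr1 ( *%R (niso (tnorm t) t)%:R)).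
  rewrite mulrBr mulrDr -![_ * _]/(ncoef _ t) ncoef_uact_series ncoef_prelie.
  rewrite -/(x t) => h.
  have -> : cutexp o (qtwist qvar x) t = \sum_(k < psize t) k`!%:R^-1 *
      iter k (cutact o) (ncoef (qscale qvar Omegaq)) t.
    apply: eq_bigr => k _; congr (_ * _); apply: iter_cutact_local => u _.
    by rewrite /qtwist /x /ncoef /qscale rsize_tclass mulrCA.
  rewrite h; congr (_ + _).
    by apply: eq_bigr => c _; rewrite ncoef_bullet.
  by rewrite /ncoef /plscale mulrCA -/(ncoef _ t) ncoef_bullet.
have oS (S : mulrClosed {poly rat}) t : o t \in localized S.
  by rewrite /o ncoef_scalars rat_Qq_localized.
have factS (S : mulrClosed {poly rat}) k : k`!%:R^-1 \in localized S.
  by rewrite -(rmorph_nat rat_Qq) -fmorphV rat_Qq_localized.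
have qS (S : mulrClosed {poly rat}) : qvar \in localized S by exact: localized_poly.
pose L : {poly rat} := \prod_(2 <= d < n.+1) map_poly intr 'Phi_d.
have Lx t : (psize t <= n)%N -> exists p, L%:F * x t = p%:F.
  (* Interpolation controls the poles away from q = 0, the recursion on size the one at q = 0. *)
  move=> ht; apply: localized_powX_at0.
    apply: (qequation_integral natr_Qq_neq0 _ qnat_qvar_inj ho _ _ _ _ expr_qvar_neq1 hx ht).
    - by rewrite /qvar tofrac_eq0 polyX_eq0.
    - exact: qS.
    - by apply: localized_inv; apply/asboolP; exists 1%N.
    - exact: factS.
    - exact: oS.
    - move=> k /qpoly_dvd /dvdpP[c hc]; exists c%:F; first exact: localized_poly.
      by rewrite qnat_qvar -tofracM /L hc.
  rewrite rpredM ?localized_poly //.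
  apply: (qequation_rpred _ (qS _) _ (factS _) expr_qvar_neq1 (oS _) hx) => k.
  rewrite /qvar -tofracXn -tofrac1 -tofracB; apply: localized_inv.
  by rewrite unfold_in hornerD hornerN hornerXn hornerC expr0n sub0r oppr_eq0 oner_eq0.
apply: clear_common_denominator.
  by rewrite monic_neq0 // monic_prod // => d _; rewrite monic_map ?Cyclotomic_monic.
move=> T; rewrite /homog; case: eqP => [hT|_]; last by exists 0; rewrite mulr0 tofrac0.
have [|p hp] := Lx (ptree_of T); first by rewrite -/(rsize T) hT.
set w := niso (tnorm T) T.
have w_gt0 : (0 < w)%N by apply/iso_niso_gt0/tnorm_iso; exact: tnorm_idem.
have w0 : w%:R != 0 :> Qq by rewrite -(prednK w_gt0) natr_Qq_neq0.
(* Undoing the normalisation divides by a nonzero rational only. *)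
exists ((w%:R^-1)%:P * p); rewrite tofracM -hp /x /ncoef ptree_ofK -/w.
by rewrite -[(_%:P)%:F]/(rat_Qq _) fmorphV rmorph_nat mulrCA mulKf.
Qed.
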